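(* Fix $L>0$ and $p\in(1,\infty)$. For $\theta\in(0,1]$ define the $L$-periodic step function $$b_\theta(x):=\sum_{k\in\mathbb{Z}}\theta^{-1/p}\chi_{I_k}(x/L),\qquad I_k:=k+[0,\theta],$$ where $\chi_I$ is the characteristic function of $I$. For each $\beta>0$ choose $\theta(\beta)\in(0,1]$ such that $c^*(\beta^{1/p}b_{\theta(\beta)})=\max_{\theta\in(0,1]}c^*(\beta^{1/p}b_\theta)$. Then $$\theta(\beta)\to0\quad\text{and}\quad \frac{c^*(\beta^{1/p}b_{\theta(\beta)})}{\beta^{1/(2p)}}\to\infty\qquad\text{as }\beta\to\infty.$$
   Context: For $\lambda\in\mathbb{R}$ and a real $L$-periodic function $b\in L^1_{\rm loc}(\mathbb{R})$, $k(\lambda,b)\in\mathbb{R}$ denotes the principal eigenvalue of $-L_{\lambda,b}\psi:=-\psi''-2\lambda\psi'-(b(x)+\lambda^2)\psi$ on $\mathbb{R}/L\mathbb{Z}$, i.e. the unique real number for which $-L_{\lambda,b}\psi=k(\lambda,b)\psi$ has an $L$-periodic positive solution $\psi$. For $b\ge0$, $b\not\equiv0$, the minimal speed of pulsating traveling waves of $u_t=u_{xx}+b(x)(1-u)u$ is $c^*(b)=\min_{\lambda>0}\frac{-k(\lambda,b)}{\lambda}$. *)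

(* Defs.v *)
From HB Require Import structures.
From mathcomp Require Import all_boot all_order all_algebra.
From mathcomp Require Import all_classical all_reals all_analysis.
Import Order.TTheory GRing.Theory Num.Theory.
Import numFieldNormedType.Exports.

Set Implicit Arguments.
Unset Strict Implicit.
Unset Printing Implicit Defensive.

Local Open Scope classical_set_scope.
Local Open Scope ring_scope.

(* - psi'' - 2 lam psi' - (b + lam^2) psi = k psi for a coefficient b that is
   only locally integrable: psi'' is a locally integrable function, i.e. psi
   is C^1 with psi' absolutely continuous, and the equation holds almost
   everywhere.  This is expressed by the integrated form of the equation; its
   integrand is locally integrable because b is and psi is C^1. *)
Definition eigen_solution {R : realType} (lam : R) (b : R -> R) (k : R)
    (psi : R -> R) : Prop :=
  [/\ forall x, derivable psi x 1,
      continuous (derive1 psi)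
    & forall x y, x <= y ->
        derive1 psi y - derive1 psi x =
        - \int[lebesgue_measure]_(t in `[x, y])
            (2 * lam * derive1 psi t + (b t + lam ^+ 2) * psi t + k * psi t) ].

Definition is_principal_eigenvalue {R : realType} (L lam : R) (b : R -> R)
    (k : R) : Prop :=
  exists psi : R -> R,
    [/\ forall x, 0 < psi x, periodic psi L & eigen_solution lam b k psi].

(* [get] selects an element of a set and returns a default value on the empty
   set; for L > 0 and b locally integrable and L-periodic, the set below is a
   singleton. *)
Definition principal_eigenvalue {R : realType} (L lam : R) (b : R -> R) : R :=
  get [set k | is_principal_eigenvalue L lam b k].

Definition minima {R : realType} (A : set R) : set R := A `&` lbound A.

(* c^*(b); the minimum is attained for L > 0 and b >= 0 locally integrable,
   L-periodic and not almost everywhere 0. *)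
Definition min_speed {R : realType} (L : R) (b : R -> R) : R :=
  get (minima [set - principal_eigenvalue L lam b / lam
              | lam in [set lam : R | 0 < lam]]).

(* The sum has finitely many nonzero terms at every x.  For theta = 1 the
   closed intervals I_k overlap at the integers, a null set. *)
Definition step_function {R : realType} (L p theta : R) (x : R) : R :=
  \sum_(k \in [set: int])
    theta `^ (- p^-1) * \1_(`[k%:~R, k%:~R + theta] : set R) (x / L).

(* Main.v *)
(** For [psi > 0] the function [w = lam + psi'/psi] solves the Riccati equation
    [w' = K - b - w^2], where [K = - k(lam, b)], and has mean [lam].  Comparison
    arguments for this equation give, for a step potential of height [h] on
    bumps of length [m], that [K <= h + lam^2], [lam^2 <= K] and
    [h - K < (pi / m)^2].  Hence [c^* <= 2 sqrt h] always, whereas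
    [K >= max (lam^2, h / 2)], and so [c^* >= sqrt (h / 2)], once [h m^2] is
    large.  With [h = (beta / theta)^(1/p)] the lower bound for a small fixed
    [theta] makes the maximal speed exceed any multiple of [beta^(1/(2p))], and
    the upper bound then forces [theta (beta)] to vanish.

    As the speed is a minimum over [lam] of quotients of eigenvalues, the lower
    bound also requires that the principal eigenvalue exists for every
    [lam > 0] (Floquet theory with explicit hyperbolic and trigonometric
    pieces) and depends continuously on [lam]. *)
Require Import Defs.
From mathcomp Require Import all_boot all_order all_algebra.
From mathcomp Require Import all_classical all_reals all_analysis.
From mathcomp Require Import measurable_realfun ring lra.
Import Order.TTheory GRing.Theory Num.Theory.
Import numFieldNormedType.Exports.

Local Open Scope classical_set_scope.
Local Open Scope ring_scope.

(** * Calculus on the real line *)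

Section real_calculus.
Context {R : realType}.
Implicit Types (f g df W dW r E : R -> R) (a b c x y m L : R).

Lemma is_derive_cast {f x a b} :
  is_derive x 1 f a -> a = b -> is_derive x 1 f b.
Proof. by move=> df <-. Qed.

Lemma der_cst c x : is_derive x 1 (fun _ => c) 0.
Proof. exact: is_derive_cst. Qed.

Lemma der_id x : is_derive x 1 (fun t : R => t) 1.
Proof. exact: is_derive_id. Qed.

Lemma der_add {f g x a b} : is_derive x 1 f a -> is_derive x 1 g b ->
  is_derive x 1 (fun t => f t + g t) (a + b).
Proof. by move=> df dg; apply: (is_deriveD (f := f) (g := g)). Qed.

Lemma der_opp {f x a} : is_derive x 1 f a -> is_derive x 1 (fun t => - f t) (- a).
Proof. by move=> df; apply: (is_deriveN (f := f)). Qed.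

Lemma der_sub {f g x a b} : is_derive x 1 f a -> is_derive x 1 g b ->
  is_derive x 1 (fun t => f t - g t) (a - b).
Proof. by move=> df dg; apply: (is_deriveB (f := f) (g := g)). Qed.

Lemma der_mul {f g x a b} : is_derive x 1 f a -> is_derive x 1 g b ->
  is_derive x 1 (fun t => f t * g t) (a * g x + f x * b).
Proof.
move=> df dg; apply: is_derive_cast (is_deriveM (f := f) (g := g) df dg) _.
by rewrite /GRing.scale/=; ring.
Qed.

Lemma der_scale c {f x a} : is_derive x 1 f a ->
  is_derive x 1 (fun t => c * f t) (c * a).
Proof.
move=> df; apply: is_derive_cast (der_mul (der_cst c x) df) _; ring.
Qed.

Lemma der_comp {f g x a b} : is_derive (g x) 1 f a -> is_derive x 1 g b ->
  is_derive x 1 (fun t => f (g t)) (a * b).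
Proof. exact: is_derive1_comp. Qed.

Lemma der_inv {f x a} : f x != 0 -> is_derive x 1 f a ->
  is_derive x 1 (fun t => (f t)^-1) (- a / f x ^+ 2).
Proof.
move=> f0 df; apply: is_derive_cast (is_deriveV f0 df) _.
by rewrite /GRing.scale/=; ring.
Qed.

Lemma der_exp {f x a} : is_derive x 1 f a ->
  is_derive x 1 (fun t => expR (f t)) (expR (f x) * a).
Proof. by move=> df; apply: der_comp df; exact: is_derive_expR. Qed.

Lemma der_lin c x : is_derive x 1 (fun t : R => c * t) c.
Proof. by apply: is_derive_cast (der_scale c (der_id x)) _; rewrite mulr1. Qed.

Lemma der_shift {f} c {x a} : is_derive (x - c) 1 f a ->
  is_derive x 1 (fun t => f (t - c)) a.
Proof.
move=> df; apply: is_derive_cast (der_comp (g := fun t => t - c) (b := 1) df _) _.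
  by apply: is_derive_cast (der_sub (der_id x) (der_cst c x)) _; rewrite subr0.
by rewrite mulr1.
Qed.

Lemma der_refl {f} c {x a} : is_derive (c - x) 1 f a ->
  is_derive x 1 (fun t => f (c - t)) (- a).
Proof.
move=> df; apply: is_derive_cast (der_comp (g := fun t => c - t) (b := -1) df _) _.
  by apply: is_derive_cast (der_sub (der_cst c x) (der_id x)) _; rewrite sub0r.
by rewrite mulrN1.
Qed.

Lemma is_derive_continuous {f x a} :
  is_derive x 1 f a -> {for x, continuous f}.
Proof. by case=> df _; exact/differentiable_continuous/derivable1_diffP. Qed.

Lemma is_derive_derive1 {f x a} : is_derive x 1 f a -> derive1 f x = a.
Proof. by case=> _ <-; rewrite derive1E. Qed.

Lemma derivable_is_derive {f x} : derivable f x 1 -> is_derive x 1 f (derive1 f x).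
Proof. by move=> df; apply: DeriveDef => //; rewrite derive1E. Qed.

Lemma derivable_continuous {f} : (forall x, derivable f x 1) -> continuous f.
Proof. by move=> df x; exact/differentiable_continuous/derivable1_diffP. Qed.

Lemma continuous_mul f g :
  continuous f -> continuous g -> continuous (fun x => f x * g x).
Proof. by move=> cf cg x; apply: cvgM; [exact: cf|exact: cg]. Qed.

Lemma continuous_add f g :
  continuous f -> continuous g -> continuous (fun x => f x + g x).
Proof. by move=> cf cg x; apply: cvgD; [exact: cf|exact: cg]. Qed.

Lemma continuous_sub f g :
  continuous f -> continuous g -> continuous (fun x => f x - g x).
Proof. by move=> cf cg x; apply: cvgB; [exact: cf|exact: cg]. Qed.

Lemma continuous_compR {f g} :
  continuous f -> continuous g -> continuous (fun x => g (f x)).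
Proof. by move=> cf cg x; apply: (continuous_comp (cf x)); exact: cg. Qed.

Lemma continuous_inv f :
  (forall x, f x != 0) -> continuous f -> continuous (fun x => (f x)^-1).
Proof. by move=> f0 cf x; apply: cvgV; [exact: f0|exact: cf]. Qed.

Lemma continuous_opp f : continuous f -> continuous (fun x => - f x).
Proof. by move=> cf x; apply: cvgN; exact: cf. Qed.

Lemma mean_value f df a b : a < b -> continuous f ->
  (forall x, a < x < b -> is_derive x 1 f (df x)) ->
  exists2 c, a < c < b & f b - f a = df c * (b - a).
Proof.
move=> ab cf fdf.
have fdf' x : x \in `]a, b[ -> is_derive x 1 f (df x).
  by rewrite in_itv/=; exact: fdf.
have [c cab ->] := MVT ab fdf' (continuous_subspaceT cf).
by exists c => //; rewrite in_itv/= in cab.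
Qed.

Lemma derive_pos_lt f df a b : a < b -> continuous f ->
  (forall x, a < x < b -> is_derive x 1 f (df x)) ->
  (forall x, a < x < b -> 0 < df x) -> f a < f b.
Proof.
move=> ab cf fdf dfp; have [c cab e] := mean_value f df a b ab cf fdf.
by rewrite -subr_gt0 e mulr_gt0 ?subr_gt0// dfp.
Qed.

(* [m] is the only point of [0, L] where [W] may fail to be differentiable. *)
Lemma derive_pos_lt_break W dW m L x : 0 < m <= L -> 0 < x <= L ->
  continuous W ->
  (forall t, 0 < t < m \/ m < t < L -> is_derive t 1 W (dW t)) ->
  (forall t, 0 < t < m \/ m < t < L -> 0 < dW t) -> W 0 < W x.
Proof.
move=> /andP[m0 mL] /andP[x0 xL] cW WdW dWp.
have [xm|mx] := leP x m.
  by apply: (derive_pos_lt W dW) => // t /andP[t0 tx];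
    [apply: WdW|apply: dWp]; left; rewrite t0 (lt_le_trans tx).
apply: (@lt_trans _ _ (W m)); apply: (derive_pos_lt W dW) => // t /andP[t0 tx];
  by [apply: WdW; left; rewrite t0|apply: dWp; left; rewrite t0|
      apply: WdW; right; rewrite t0 (lt_le_trans tx)|
      apply: dWp; right; rewrite t0 (lt_le_trans tx)].
Qed.

(* The argument behind most comparisons of eigenfunctions: [W] is an increasing
   multiple of [r'] which is magnified by a factor [c > 1] over one period,
   hence positive, so that [r] cannot be periodic. *)
Lemma magnified_derive_lt W dW r E c m L : 0 < m <= L -> 1 < c ->
  continuous W ->
  (forall t, 0 < t < m \/ m < t < L -> is_derive t 1 W (dW t)) ->
  (forall t, 0 < t < m \/ m < t < L -> 0 < dW t) ->
  W L = c * W 0 -> (forall t, 0 < E t) ->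
  (forall t : R, is_derive t 1 r (W t * E t)) -> r 0 < r L.
Proof.
move=> mL c1 cW WdW dWp WL Ep dr.
have L0 : 0 < L by case/andP: mL; exact: lt_le_trans.
have W0L : W 0 < W L by apply: (derive_pos_lt_break W dW m L L); rewrite ?L0/=.
have W0 : 0 < W 0.
  by rewrite -(pmulr_rgt0 _ (_ : 0 < c - 1)) ?subr_gt0// mulrBl mul1r -WL subr_gt0.
apply: (derive_pos_lt r (fun t => W t * E t)) => //.
  by move=> x; exact: is_derive_continuous (dr x).
move=> x /andP[x0 xL]; rewrite mulr_gt0//; apply: (lt_trans W0).
by apply: (derive_pos_lt_break W dW m L x) => //; rewrite x0 ltW.
Qed.

(** Supremum argument on the points [u] of [[x, y]] with [P x u]: the left germ at the supremum
    shows that it belongs to the set, and the right germ would push it further if it were below [y].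
    It carries identities across any number of breakpoints without enumerating them. *)
Lemma local_to_global (P : R -> R -> Prop) :
  (forall x, P x x) ->
  (forall x y z, x <= y <= z -> P x y -> P y z -> P x z) ->
  (forall z, exists2 e, 0 < e & forall x, z - e <= x <= z -> P x z) ->
  (forall z, exists2 e, 0 < e & forall x, z <= x <= z + e -> P z x) ->
  forall x y, x <= y -> P x y.
Proof.
move=> P0 PD Pl Pr x y xy.
pose A := [set u | x <= u <= y /\ P x u].
have Ax : A x by split => //; rewrite lexx.
have supA : has_sup A by split; [exists x|exists y => u [/andP[]]].
set s := sup A.
have As u : A u -> u <= s.
  by move=> Au; apply: ub_le_sup => //; case: supA.
have xs : x <= s by exact: As.
have sy : s <= y by apply: ge_sup; [exists x|move=> u [/andP[]]].
have Pxs : P x s.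
  have [e e0 Ps] := Pl s.
  have [u [/andP[xu uy] Pu] us] := sup_adherent e0 supA.
  have us' : u <= s by apply: As; split => //; rewrite xu.
  by apply: (PD x u s) => //; [rewrite xu|apply: Ps; rewrite us' ltW].
have [<-//|/eqP sney] := pselect (s = y).
have slty : s < y by rewrite lt_neqAle sney.
have [e e0 Ps] := Pr s; pose u := Num.min y (s + e).
have su : s < u by rewrite lt_min slty ltrDl.
have : u <= s.
  apply: As; split; first by rewrite (le_trans xs (ltW su)) ge_min lexx.
  apply: (PD x s u) => //; first by rewrite xs ltW.
  by apply: Ps; rewrite (ltW su) ge_min lexx orbT.
by rewrite leNgt su.
Qed.

(** * Integrals over segments *)

Lemma continuous_integrable_itv f a b : continuous f ->
  lebesgue_measure.-integrable `[a, b] (EFin \o f).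
Proof.
move=> cf; apply: continuous_compact_integrable; first exact: segment_compact.
exact: continuous_subspaceT.
Qed.

Lemma Rintegral_derive f df a b : a <= b ->
  (forall x : R, is_derive x 1 f (df x)) -> continuous df ->
  \int[lebesgue_measure]_(t in `[a, b]) df t = f b - f a.
Proof.
rewrite le_eqVlt => /predU1P[<-|ab] fdf cdf.
  by rewrite set_itv1 Rintegral_set1 subrr.
have cf : continuous f by move=> x; exact: is_derive_continuous (fdf x).
rewrite /Rintegral (@continuous_FTC2 _ _ f)//.
- exact: continuous_subspaceT.
- split; first by move=> x _; case: (fdf x).
  + exact/cvg_at_right_filter/cf.
  + exact/cvg_at_left_filter/cf.
- by move=> x _; exact: is_derive_derive1.
Qed.

(** Nothing is assumed about [f] at [a] and [b], where a potential may jump: endpoints affect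
    neither measurability nor the integral. *)
Lemma integrable_eq_oo f g a b : continuous g ->
  (forall x, a < x < b -> f x = g x) ->
  lebesgue_measure.-integrable `[a, b] (EFin \o f) /\
  \int[lebesgue_measure]_(t in `[a, b]) f t =
  \int[lebesgue_measure]_(t in `[a, b]) g t.
Proof.
move=> cg fg.
have fg' : {in `]a, b[%classic, g =1 f}.
  by move=> x; rewrite inE/= in_itv/= => /fg ->.
have mg : measurable_fun `]a, b[ g.
  have /measurable_int/measurable_EFinP := continuous_integrable_itv g a b cg.
  by apply: measurable_funS => //; exact: subset_itv_oo_cc.
have mf : measurable_fun `]a, b[ f by exact: eq_measurable_fun mg.
have mfcc : measurable_fun `[a, b] f.
  by apply/measurable_fun_itv_obnd_cbndP/measurable_fun_itv_bndo_bndcP.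
split; last first.
  by rewrite /Rintegral; congr fine; apply: eq_integral_itv_bounded.
have /integrableP[_ gfin] := continuous_integrable_itv g a b cg.
apply/integrableP; split; first exact/measurable_EFinP.
apply: le_lt_trans gfin.
rewrite (eq_integral_itv_bounded (f := fun x => `|f x|) (g := fun x => `|g x|))//.
- by apply: measurableT_comp mf.
- by apply: measurableT_comp mg.
- by move=> x; rewrite in_itv/= => /fg ->.
Qed.

Lemma Rintegral_chain f a b c : a <= b <= c ->
  lebesgue_measure.-integrable `[a, b] (EFin \o f) ->
  lebesgue_measure.-integrable `[b, c] (EFin \o f) ->
  lebesgue_measure.-integrable `[a, c] (EFin \o f) /\
  \int[lebesgue_measure]_(t in `[a, c]) f t =
  \int[lebesgue_measure]_(t in `[a, b]) f t +
  \int[lebesgue_measure]_(t in `[b, c]) f t.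
Proof.
move=> /andP[ab bc] iab ibc.
have ibc' : lebesgue_measure.-integrable `]b, c] (EFin \o f).
  by apply: integrableS ibc => //; exact: subset_itv_oc_cc.
have iac : lebesgue_measure.-integrable `[a, c] (EFin \o f).
  have -> : `[a, c]%classic = `[a, b]%classic `|` `]b, c]%classic.
    by rewrite -itv_bndbnd_setU ?bnd_simp.
  have mU : measurable (`[a, b]%classic `|` `]b, c]%classic) by exact: measurableU.
  have /integrableP[mab fab] := iab.
  have /integrableP[mbc fbc] := ibc'.
  apply/integrableP; split; first exact/measurable_funU.
  rewrite ge0_integral_setU//.
  - by rewrite lte_add_pinfty.
  - by apply: measurableT_comp => //; exact/measurable_funU.
  - rewrite disj_set2E; apply/eqP/seteqP; split => // x /=.
    by rewrite !in_itv/= => -[/andP[_ xb] /andP[+ _]]; rewrite ltNge xb.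
split=> //.
rewrite -(Rintegral_itv_obnd_cbnd (r := b)) -?(Rintegral_itvB (x := b) iac) ?bnd_simp//.
  by rewrite addrC subrK.
Qed.

End real_calculus.

(** * Comparison of eigenfunctions *)

Section comparison.
Context {R : realType}.
Implicit Types (L m h lam k x : R) (b psi : R -> R).

(** The values at the breakpoints are left free, and [m = L] makes the second clause vacuous, so
    that [theta = 1] is covered. *)
Definition two_step L m h b : Prop :=
  (forall x, 0 < x < m -> b x = h) /\ (forall x, m < x < L -> b x = 0).

(** Where [b] is constant the integrand agrees with a continuous function, so the fundamental
    theorem of calculus turns the integrated equation into a pointwise one. *)
Lemma eigen_derive2 lam b k psi u v c x : eigen_solution lam b k psi ->
  (forall t, u < t < v -> b t = c) -> u < x < v ->
  is_derive x 1 (derive1 psi)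
    (- (2 * lam * derive1 psi x + (c + lam ^+ 2) * psi x + k * psi x)).
Proof.
move=> [dpsi cdpsi eqn] bc /andP[ux xv].
pose g t := 2 * lam * derive1 psi t + (c + lam ^+ 2) * psi t + k * psi t.
have cpsi : continuous psi by exact: derivable_continuous dpsi.
have cc (d : R) : continuous (fun _ : R => d) by move=> ?; exact: cvg_cst.
have cg : continuous g.
  by do 2?apply: continuous_add; apply: continuous_mul => //; exact: cc.
(* The midpoints give a closed interval around [x] that stays inside the open one where [b = c]. *)
pose a := (u + x) / 2; pose w := (x + v) / 2.
have ua : u < a by rewrite /a; lra.
have ax : a < x by rewrite /a; lra.
have xw : x < w by rewrite /w; lra.
have wv : w < v by rewrite /w; lra.
have [dF F'] := continuous_FTC1_closed xw (continuous_integrable_itv g a w cg) ax (cg x).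
pose F y := \int[lebesgue_measure]_(t in `[a, y]) g t.
have dFx : is_derive x 1 F (g x) by rewrite -F'; exact: derivable_is_derive.
have : is_derive x 1 (fun y => derive1 psi a - F y) (- g x).
  by apply: is_derive_cast (der_sub (der_cst _ x) dFx) _; rewrite sub0r.
apply: near_eq_is_derive.
have : \forall y \near x, y \in `]a, w[ by apply: near_in_itvoo; rewrite in_itv/= ax.
apply: filterS => y; rewrite in_itv/= => /andP[ay yw].
have /eqP := eqn a y (ltW ay); rewrite subr_eq addrC => /eqP ->.
congr (_ - _); apply: eq_Rintegral => t; rewrite inE/= in_itv/= => /andP[at' ty].
by rewrite /g bc// (lt_le_trans ua)//= (le_lt_trans ty)// (lt_trans yw).
Qed.

Lemma periodic_derive1 {psi L} : (forall x : R, derivable psi x 1) ->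
  periodic psi L -> periodic (derive1 psi) L.
Proof.
move=> dpsi ppsi x.
have dxL := derivable_is_derive (dpsi (x + L)).
have := @der_shift _ psi (- L) x (derive1 psi (x + L)).
rewrite opprK => /(_ dxL); rewrite (_ : (fun t => _) = psi) => [|].
  by move/is_derive_derive1.
by apply/funext => t; exact: ppsi.
Qed.

Lemma periodicL {psi L} : periodic psi L -> psi L = psi 0.
Proof. by move=> /(_ 0); rewrite add0r. Qed.

Lemma expR_continuous (c : R) : continuous (fun x => expR (c * x)).
Proof. by move=> x; exact: is_derive_continuous (der_exp (der_lin c x)). Qed.

Lemma expR_period L lam : 0 < L -> 0 < lam -> 1 < expR (2 * lam * L).
Proof. by move=> L0 l0; rewrite expR_gt1 !mulr_gt0. Qed.

(* What remains of a positive periodic eigenfunction [psi], with derivative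
   [v], once the potential is known to be a two-step function on [0, L]. *)
Record step_eigenpair (L m lam : R) b (k : R) (psi v : R -> R) : Prop := {
  pair_gt0 : forall x, 0 < psi x;
  pair_derive : forall x : R, is_derive x 1 psi (v x);
  pair_continuous1 : continuous v;
  pair_period : psi L = psi 0;
  pair_period1 : v L = v 0;
  pair_derive2 : forall x, 0 < x < m \/ m < x < L ->
    is_derive x 1 v (- (2 * lam * v x + (b x + lam ^+ 2) * psi x + k * psi x)) }.

Lemma eigen_pair L m h lam b k psi : two_step L m h b ->
  (forall x, 0 < psi x) -> periodic psi L -> eigen_solution lam b k psi ->
  step_eigenpair L m lam b k psi (derive1 psi).
Proof.
move=> [bl br] psi0 psiL eig; have [dpsi cdpsi _] := eig; split.
- exact: psi0.
- by move=> x; exact: derivable_is_derive.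
- exact: cdpsi.
- exact: periodicL.
- by apply: periodicL; exact: (periodic_derive1 dpsi psiL).
- move=> x [] hx.
  + by rewrite bl//; exact: (eigen_derive2 _ _ _ _ _ _ _ _ eig bl hx).
  + by rewrite br//; exact: (eigen_derive2 _ _ _ _ _ _ _ _ eig br hx).
Qed.

(** * Bounds on the eigenvalue from a single eigenfunction *)

Section one_eigenfunction.
Variables (L m h lam k : R) (b psi v : R -> R).
Hypotheses (hm : 0 < m <= L) (bstep : two_step L m h b).
Hypothesis (ep : step_eigenpair L m lam b k psi v).

Let L_gt0 : 0 < L. Proof. by case/andP: hm; exact: lt_le_trans. Qed.

Let psi_gt0 := pair_gt0 _ _ _ _ _ _ _ ep.
Let dpsi := pair_derive _ _ _ _ _ _ _ ep.
Let cv := pair_continuous1 _ _ _ _ _ _ _ ep.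
Let psiL := pair_period _ _ _ _ _ _ _ ep.
Let vL := pair_period1 _ _ _ _ _ _ _ ep.
Let dv := pair_derive2 _ _ _ _ _ _ _ ep.

Let psi_neq0 x : psi x != 0. Proof. exact: lt0r_neq0. Qed.

Lemma pair_continuous : continuous psi.
Proof. by move=> x; exact: is_derive_continuous (dpsi x). Qed.

Lemma step_two_values x : 0 < x < m \/ m < x < L -> b x = h \/ b x = 0.
Proof. by case: bstep => bl br [/bl|/br]; [left|right]. Qed.

Let dpsiV (t : R) : is_derive t 1 (fun x => (psi x)^-1) (- v t / psi t ^+ 2).
Proof. exact: der_inv (psi_neq0 t) (dpsi t). Qed.

(** The equation reads [(e^(2 lam x) psi')' = - e^(2 lam x) (b + lam^2 + k) psi]. If the bound
    failed, the right side would be positive, and [psi] would increase over a period. *)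
Lemma eigen_le_sup : 0 <= h -> 0 < lam -> - k <= h + lam ^+ 2.
Proof.
move=> h0 l0; rewrite leNgt; apply/negP => hk.
suff : psi 0 < psi L by rewrite psiL ltxx.
apply: (magnified_derive_lt (fun x => expR (2 * lam * x) * v x)
  (fun x => expR (2 * lam * x) * (- (b x + lam ^+ 2 + k) * psi x))
  psi (fun x => expR (- (2 * lam) * x)) (expR (2 * lam * L)) m L).
- exact: hm.
- exact: expR_period.
- by apply: continuous_mul; [exact: expR_continuous|exact: cv].
- move=> t ht; apply: is_derive_cast (der_mul (der_exp (der_lin _ _)) (dv _ ht)) _.
  by rewrite /=; ring.
- move=> t ht; rewrite mulr_gt0 ?expR_gt0// mulr_gt0// oppr_gt0.
  by case: (step_two_values _ ht) => ->; lra.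
- by rewrite vL mulr0 expR0 mul1r.
- by move=> t; exact: expR_gt0.
- move=> t; apply: is_derive_cast (dpsi t) _.
  by rewrite mulrAC -expRD mulNr subrr expR0 mul1r.
Qed.

(** For [q = psi'/psi] one has [(- e^(2 lam x) q)' = e^(2 lam x) (b + lam^2 + k + q^2)]. If the
    bound failed, this would be positive, and [- ln psi] would increase over a period. *)
Lemma eigen_ge_sqr : 0 <= h -> 0 < lam -> lam ^+ 2 <= - k.
Proof.
move=> h0 l0; rewrite leNgt; apply/negP => hk.
suff : - ln (psi 0) < - ln (psi L) by rewrite psiL ltxx.
apply: (magnified_derive_lt
  (fun x => - (expR (2 * lam * x) * (v x * (psi x)^-1)))
  (fun x => expR (2 * lam * x) * (b x + lam ^+ 2 + k + (v x / psi x) ^+ 2))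
  (fun x => - ln (psi x)) (fun x => expR (- (2 * lam) * x))
  (expR (2 * lam * L)) m L).
- exact: hm.
- exact: expR_period.
- apply: continuous_opp; apply: continuous_mul; first exact: expR_continuous.
  apply: continuous_mul; first exact: cv.
  by apply: continuous_inv; [exact: psi_neq0|exact: pair_continuous].
- move=> t ht; apply: is_derive_cast
    (der_opp (der_mul (der_exp (der_lin _ _)) (der_mul (dv _ ht) (dpsiV t)))) _.
  by have := psi_neq0 t; rewrite /= => pn; field.
- move=> t ht; rewrite mulr_gt0 ?expR_gt0// ltr_wpDr ?sqr_ge0//.
  by case: (step_two_values _ ht) => ->; lra.
- by rewrite vL psiL mulr0 expR0 mul1r mulrN.
- by move=> t; exact: expR_gt0.
- move=> t.
  apply: is_derive_cast (der_opp (der_comp (is_derive1_ln (psi_gt0 t)) (dpsi t))) _.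
  by rewrite mulNr mulrAC -expRD mulNr subrr expR0 mul1r mulrC.
Qed.

(* On the bump, [w = lam + v/psi] solves [w' = - (h + k) - w^2], so that
   [atan (w / gam) + gam x] is constant for [gam = sqrt (h + k)]. *)
Lemma eigen_bump_lt_pi : (h + k) * m ^+ 2 < pi ^+ 2.
Proof.
case/andP: hm => m0 _.
have [hk|hk] := leP (h + k) 0.
  apply: (@le_lt_trans _ _ 0); last by rewrite exprn_gt0// pi_gt0.
  by rewrite mulr_le0_ge0// sqr_ge0.
pose gam := Num.sqrt (h + k).
have g0 : 0 < gam by rewrite sqrtr_gt0.
have g2 : h + k = gam ^+ 2 by rewrite sqr_sqrtr// ltW.
pose w (x : R) : R := (lam + v x * (psi x)^-1) * gam^-1.
have cw : continuous w.
  apply: continuous_mul => [|x]; last exact: cvg_cst.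
  apply: continuous_add => [x|]; first exact: cvg_cst.
  apply: continuous_mul; first exact: cv.
  by apply: continuous_inv; [exact: psi_neq0|exact: pair_continuous].
have [|t ht|c _] := mean_value (fun x => atan (w x) + gam * x) (fun=> 0) 0 m m0.
- apply: continuous_add => x.
    by apply: continuous_comp; [exact: cw|exact: continuous_atan].
  exact: is_derive_continuous (der_lin gam x).
- have D := dv t (or_introl ht).
  apply: is_derive_cast (der_add (der_comp (is_derive1_atan _)
      (der_mul (der_add (der_cst _ _) (der_mul D (dpsiV t))) (der_cst _ _))) (der_lin _ _)) _.
  case: bstep => bl _; rewrite bl//= /w.
  have pn := psi_neq0 t; have gn := lt0r_neq0 g0.
  have -> : k = gam ^+ 2 - h by rewrite -g2; ring.
  have den : (psi t * gam) ^+ 2 + (lam * psi t + v t) ^+ 2 != 0.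
    by rewrite lt0r_neq0// ltr_pwDl ?sqr_ge0// exprn_gt0// mulr_gt0.
  by field; rewrite pn gn/= den.
- rewrite mul0r mulr0 addr0 => /eqP; rewrite subr_eq0 => /eqP e.
  (* Two values of [atan] differ by less than [pi]. *)
  have e' : gam * m = atan (w 0) - atan (w m) by rewrite -e; ring.
  have gm : gam * m < pi.
    rewrite e'; have := atan_ltpi2 (w 0); have := atan_gtNpi2 (w m); lra.
  by rewrite g2 -exprMn ltr_pXn2r// nnegrE ?pi_ge0// mulr_ge0// ltW.
Qed.

End one_eigenfunction.

(** The weighted Wronskian [e^(2 lam2 x) (psi1' psi2 - psi1 psi2')] is a positive multiple of
    [(psi1/psi2)']; in its derivative [b] cancels, leaving the bracket times [e^(2 lam2 x) psi2]. If
    [s] times the bracket were positive throughout, [s psi1/psi2] could not be periodic. The factor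
    [s] treats both signs at once. *)
Lemma eigen_compare L m lam1 k1 psi1 v1 lam2 k2 psi2 v2 b (s : R) :
  0 < m <= L -> 0 < lam2 ->
  step_eigenpair L m lam1 b k1 psi1 v1 -> step_eigenpair L m lam2 b k2 psi2 v2 ->
  ~ (forall x, 0 < x < L -> 0 < s * ((k2 - k1 + lam2 ^+ 2 - lam1 ^+ 2) * psi1 x +
                                  2 * (lam2 - lam1) * v1 x)).
Proof.
move=> hm l0 e1 e2 Bp; have c1 := pair_continuous _ _ _ _ _ _ _ e1.
have c2 := pair_continuous _ _ _ _ _ _ _ e2.
case: e1 => p1 d1 c1' per1 per1' dv1; case: e2 => p2 d2 c2' per2 per2' dv2.
have L0 : 0 < L by case/andP: hm; exact: lt_le_trans.
have p2n x : psi2 x != 0 by exact: lt0r_neq0.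
suff : s * (psi1 0 / psi2 0) < s * (psi1 L / psi2 L) by rewrite per1 per2 ltxx.
apply: (magnified_derive_lt
  (fun x => s * (expR (2 * lam2 * x) * (v1 x * psi2 x - psi1 x * v2 x)))
  (fun x => expR (2 * lam2 * x) * (psi2 x *
     (s * ((k2 - k1 + lam2 ^+ 2 - lam1 ^+ 2) * psi1 x +
                                  2 * (lam2 - lam1) * v1 x))))
  (fun x => s * (psi1 x * (psi2 x)^-1))
  (fun x => expR (- (2 * lam2) * x) / psi2 x ^+ 2)
  (expR (2 * lam2 * L)) m L).
- exact: hm.
- exact: expR_period.
- apply: continuous_mul => [x|]; first exact: cvg_cst.
  apply: continuous_mul; first exact: expR_continuous.
  by apply: continuous_sub; apply: continuous_mul.
- move=> t ht; apply: is_derive_cast (der_scale s (der_mul (der_exp (der_lin _ _))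
    (der_sub (der_mul (dv1 t ht) (d2 t)) (der_mul (d1 t) (dv2 t ht))))) _.
  by rewrite /=; ring.
- move=> t ht; rewrite mulr_gt0 ?expR_gt0// mulr_gt0//; apply: Bp.
  case/andP: hm => m0 mL; case: ht => /andP[].
    by move=> -> /=; move/lt_le_trans; exact.
  by move=> mt ->; rewrite (lt_trans m0).
- by rewrite per1 per2 per1' per2' mulr0 expR0; ring.
- by move=> t; rewrite divr_gt0 ?expR_gt0 ?exprn_gt0.
- move=> t; apply: is_derive_cast (der_scale s (der_mul (d1 t) (der_inv (p2n t) (d2 t)))) _.
  have en : expR (2 * lam2 * t) != 0 by rewrite lt0r_neq0 ?expR_gt0.
  by have := p2n t => pn; rewrite /= (mulNr (2 * lam2)) expRN; field; rewrite pn.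
Qed.

End comparison.

(** * Floquet solutions for a step potential *)

Section generalized_trigonometry.
Context {R : realType}.
Implicit Types (f : R -> R) (z x u a : R).

(** The quotient [f u / u] with its singularity at 0 filled in by [a], meant for [a = f' 0]. It
    allows [gsin] to pass continuously through [z = 0]. *)
Definition slope f a u : R := if u == 0 then a else f u / u.

Lemma slope_mul f a u : f 0 = 0 -> slope f a u * u = f u.
Proof.
by rewrite /slope; case: eqVneq => [-> -> | u0 _]; rewrite ?mulr0// divfK.
Qed.

(** At 0, [slope f a] is the function in Caratheodory's form of differentiability. *)
Lemma slope_continuous f a :
  f 0 = 0 -> is_derive (0 : R) 1 f a -> continuous f -> continuous (slope f a).
Proof.
move=> f0 df cf u; have [->|u0] := eqVneq u 0.
  have /is_derive1_caratheodory[g [gE cg g0]] := df.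
  have -> : slope f a = g.
    apply/funext => t; rewrite /slope; case: eqVneq => [->//|t0].
    by have := gE t; rewrite f0 !subr0 => ->; rewrite mulfK.
  exact: cg.
rewrite /continuous_at {2}/slope (negbTE u0).
have : f t / t @[t --> u] --> f u / u.
  by apply: cvgM; [exact: cf|apply: cvgV => //; exact: cvg_id].
apply: cvg_trans; apply: near_eq_cvg.
have : \forall t \near u, t != 0 by exact: (cvgr_neq0 u cvg_id u0).
by apply: filterS => t t0; rewrite /slope (negbTE t0).
Qed.

Definition coshR x : R := (expR x + expR (- x)) / 2.
Definition sinhR x : R := (expR x - expR (- x)) / 2.

Lemma coshR0 : coshR 0 = 1.
Proof. by rewrite /coshR oppr0 expR0; field. Qed.

Lemma sinhR0 : sinhR 0 = 0.
Proof. by rewrite /sinhR oppr0 expR0 subrr mul0r. Qed.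

Lemma is_derive_expRN x : is_derive x 1 (fun t => expR (- t)) (- expR (- x)).
Proof. by apply: is_derive_cast (der_exp (der_opp (der_id x))) _; rewrite mulrN1. Qed.

Lemma is_derive_coshR x : is_derive x 1 coshR (sinhR x).
Proof.
apply: is_derive_cast
  (der_mul (der_add (is_derive_expR x) (is_derive_expRN x)) (der_cst 2^-1 x)) _.
by rewrite /sinhR mulr0 addr0.
Qed.

Lemma is_derive_sinhR x : is_derive x 1 sinhR (coshR x).
Proof.
apply: is_derive_cast
  (der_mul (der_sub (is_derive_expR x) (is_derive_expRN x)) (der_cst 2^-1 x)) _.
by rewrite /coshR mulr0 addr0 opprK.
Qed.

Lemma sqr_coshR_sinhR x : coshR x ^+ 2 - sinhR x ^+ 2 = 1.
Proof.
have : expR x * expR (- x) = 1 by rewrite -expRD subrr expR0.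
by rewrite /coshR /sinhR => e; rewrite -[RHS]e; field.
Qed.

Lemma sinhR_gt0 x : 0 < x -> 0 < sinhR x.
Proof. by move=> x0; rewrite divr_gt0// subr_gt0 ltr_expR; lra. Qed.

Lemma coshR_ge1 x : 1 <= coshR x.
Proof.
have := sqr_coshR_sinhR x; have := sqr_ge0 (sinhR x).
have : 0 < coshR x by rewrite divr_gt0// addr_gt0// expR_gt0.
by rewrite !expr2; nra.
Qed.

Lemma coshR_le x y : 0 <= x <= y -> coshR x <= coshR y.
Proof.
case/andP=> x0; rewrite le_eqVlt => /predU1P[->//|xy]; apply: ltW.
apply: (derive_pos_lt coshR sinhR) => //.
- by move=> t; exact: is_derive_continuous (is_derive_coshR t).
- by move=> t _; exact: is_derive_coshR.
- by move=> t /andP[xt _]; apply: sinhR_gt0; exact: le_lt_trans xt.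
Qed.

Let csinhR : continuous sinhR.
Proof. by move=> x; exact: is_derive_continuous (is_derive_sinhR x). Qed.

Let ccoshR : continuous coshR.
Proof. by move=> x; exact: is_derive_continuous (is_derive_coshR x). Qed.

Let csin : continuous (@sin R).
Proof. by move=> x; exact: is_derive_continuous (is_derive_sin x). Qed.

Let ccos : continuous (@cos R).
Proof. by move=> x; exact: is_derive_continuous (is_derive_cos x). Qed.

(* The solutions of [f'' = z f] with initial data (1, 0) and (0, 1): in each of
   the products below, one of the factors is 1 since [Num.sqrt] vanishes on
   negative numbers.  This form makes the continuity in [z] obvious. *)
Definition gcos z x : R :=
  cos (Num.sqrt (- z) * x) * coshR (Num.sqrt z * x).
Definition gsin z x : R :=
  x * (slope sin 1 (Num.sqrt (- z) * x) * slope sinhR 1 (Num.sqrt z * x)).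

Lemma gsin_pos z x : 0 < z -> gsin z x = sinhR (Num.sqrt z * x) * (Num.sqrt z)^-1.
Proof.
move=> z0; rewrite /gsin ler0_sqrtr ?oppr_le0 ?ltW// mul0r {1}/slope eqxx mul1r.
have s0 : Num.sqrt z != 0 by rewrite lt0r_neq0// sqrtr_gt0.
rewrite -(slope_mul sinhR 1 (Num.sqrt z * x)) ?sinhR0//; field.
by rewrite s0.
Qed.

Lemma gcos_pos z x : 0 <= z -> gcos z x = coshR (Num.sqrt z * x).
Proof.
by move=> z0; rewrite /gcos ler0_sqrtr ?oppr_le0// mul0r cos0 mul1r.
Qed.

Lemma gsin_neg z x : z < 0 ->
  gsin z x = sin (Num.sqrt (- z) * x) * (Num.sqrt (- z))^-1.
Proof.
move=> z0; rewrite /gsin (ler0_sqrtr (ltW z0)) mul0r {2}/slope eqxx mulr1.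
have s0 : Num.sqrt (- z) != 0 by rewrite lt0r_neq0// sqrtr_gt0 oppr_gt0.
rewrite -(slope_mul sin 1 (Num.sqrt (- z) * x)) ?sin0//; field.
by rewrite s0.
Qed.

Lemma gcos_neg z x : z <= 0 -> gcos z x = cos (Num.sqrt (- z) * x).
Proof. by move=> z0; rewrite /gcos (ler0_sqrtr z0) mul0r coshR0 mulr1. Qed.

Lemma gsin_zero x : gsin 0 x = x.
Proof. by rewrite /gsin oppr0 sqrtr0 mul0r /slope eqxx !mulr1. Qed.

Lemma gcos_zero x : gcos 0 x = 1.
Proof. by rewrite gcos_pos// sqrtr0 mul0r coshR0. Qed.

Lemma gsin0 z : gsin z 0 = 0.
Proof. by rewrite /gsin mul0r. Qed.

Lemma gcos0 z : gcos z 0 = 1.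
Proof. by rewrite /gcos !mulr0 cos0 coshR0 mulr1. Qed.

Lemma is_derive_gsin z x : is_derive x 1 (gsin z) (gcos z x).
Proof.
have [z0|z0|->] := ltgtP z 0.
- have s0 : Num.sqrt (- z) != 0 by rewrite lt0r_neq0// sqrtr_gt0 oppr_gt0.
  have -> : gsin z = fun t => sin (Num.sqrt (- z) * t) * (Num.sqrt (- z))^-1.
    by apply/funext => t; exact: gsin_neg.
  apply: is_derive_cast
    (der_mul (der_comp (is_derive_sin _) (der_lin _ _)) (der_cst _ _)) _.
  by rewrite gcos_neg ?ltW//= mulr0 addr0 mulfK.
- have s0 : Num.sqrt z != 0 by rewrite lt0r_neq0// sqrtr_gt0.
  have -> : gsin z = fun t => sinhR (Num.sqrt z * t) * (Num.sqrt z)^-1.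
    by apply/funext => t; exact: gsin_pos.
  apply: is_derive_cast
    (der_mul (der_comp (is_derive_sinhR _) (der_lin _ _)) (der_cst _ _)) _.
  by rewrite gcos_pos ?ltW//= mulr0 addr0 mulfK.
- have -> : gsin 0 = fun t => t by apply/funext => t; exact: gsin_zero.
  by rewrite gcos_zero; exact: der_id.
Qed.

Lemma is_derive_gcos z x : is_derive x 1 (gcos z) (z * gsin z x).
Proof.
have [z0|z0|->] := ltgtP z 0.
- have s0 : Num.sqrt (- z) != 0 by rewrite lt0r_neq0// sqrtr_gt0 oppr_gt0.
  have -> : gcos z = fun t => cos (Num.sqrt (- z) * t).
    by apply/funext => t; rewrite gcos_neg// ltW.
  apply: is_derive_cast (der_comp (is_derive_cos _) (der_lin _ _)) _.
  rewrite gsin_neg//; have : z = - Num.sqrt (- z) ^+ 2.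
    by rewrite sqr_sqrtr ?opprK// oppr_ge0 ltW.
  by move: (Num.sqrt (- z)) s0 => g s0 ->; field.
- have s0 : Num.sqrt z != 0 by rewrite lt0r_neq0// sqrtr_gt0.
  have -> : gcos z = fun t => coshR (Num.sqrt z * t).
    by apply/funext => t; rewrite gcos_pos// ltW.
  apply: is_derive_cast (der_comp (is_derive_coshR _) (der_lin _ _)) _.
  rewrite gsin_pos//; have : z = Num.sqrt z ^+ 2 by rewrite sqr_sqrtr// ltW.
  by move: (Num.sqrt z) s0 => g s0 ->; field.
- have -> : gcos 0 = fun _ => 1 by apply/funext => t; exact: gcos_zero.
  by rewrite mul0r; exact: der_cst.
Qed.

(** The first positive zero of [gsin z] is [pi / sqrt (- z)] for [z < 0], and there is none for
    [z >= 0]. *)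
Lemma gsin_gt0 z x : 0 < x -> - z * x ^+ 2 < pi ^+ 2 -> 0 < gsin z x.
Proof.
move=> x0; have [z0|z0|->] := ltgtP z 0; last by rewrite gsin_zero.
- have s0 : 0 < Num.sqrt (- z) by rewrite sqrtr_gt0 oppr_gt0.
  have {1}-> : - z = Num.sqrt (- z) ^+ 2 by rewrite sqr_sqrtr// oppr_ge0 ltW.
  rewrite -exprMn ltr_pXn2r ?nnegrE ?pi_ge0 ?mulr_ge0 1?ltW// => gx.
  by rewrite gsin_neg// divr_gt0// sin_gt0_pi// gx mulr_gt0.
- have s0 : 0 < Num.sqrt z by rewrite sqrtr_gt0.
  by rewrite gsin_pos// divr_gt0// sinhR_gt0// mulr_gt0.
Qed.

Lemma gsin_pi x : 0 < x -> gsin (- (pi / x) ^+ 2) x = 0.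
Proof.
move=> x0; have px : 0 < pi / x :> R by rewrite divr_gt0// pi_gt0.
rewrite gsin_neg ?oppr_lt0 ?exprn_gt0// opprK sqrtr_sqr gtr0_norm//.
by rewrite divfK ?lt0r_neq0// sinpi mul0r.
Qed.

Lemma gcos_pi x : 0 < x -> gcos (- (pi / x) ^+ 2) x = - 1.
Proof.
move=> x0; have px : 0 < pi / x :> R by rewrite divr_gt0// pi_gt0.
rewrite gcos_neg ?oppr_le0 ?sqr_ge0// opprK sqrtr_sqr gtr0_norm//.
by rewrite divfK ?lt0r_neq0// cospi.
Qed.

Let csqrt x : continuous (fun z => Num.sqrt z * x).
Proof.
by apply: continuous_mul => z; [exact: sqrt_continuous|exact: cvg_cst].
Qed.

Let csqrtN x : continuous (fun z => Num.sqrt (- z) * x).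
Proof.
apply: continuous_mul => z; last exact: cvg_cst.
apply: (continuous_comp (f := fun t => - t)); last exact: sqrt_continuous.
exact: is_derive_continuous (der_opp (der_id z)).
Qed.

Lemma gcos_continuous x : continuous (gcos^~ x).
Proof.
apply: continuous_mul; first exact: continuous_compR (csqrtN x) ccos.
exact: continuous_compR (csqrt x) ccoshR.
Qed.

Lemma gsin_continuous x : continuous (gsin^~ x).
Proof.
apply: continuous_mul => [z|]; first exact: cvg_cst.
apply: continuous_mul.
  apply: (continuous_compR (csqrtN x)); apply: slope_continuous => //.
    exact: sin0.
  by apply: is_derive_cast (is_derive_sin 0) _; rewrite cos0.
apply: (continuous_compR (csqrt x)); apply: slope_continuous => //.
  exact: sinhR0.
by apply: is_derive_cast (is_derive_sinhR 0) _; rewrite coshR0.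
Qed.

End generalized_trigonometry.

(** * Positive Floquet solutions built from two constant-coefficient pieces *)

Section floquet.
Context {R : realType}.
Implicit Types (L m h lam k z c x : R) (f w : R -> R).

(* Constant-coefficient solutions [f], with derivative [w], where the potential
   takes the value [c]. *)
Definition piece lam k c f w : Prop :=
  (forall x : R, is_derive x 1 f (w x)) /\
  (forall x : R,
     is_derive x 1 w (- (2 * lam * w x + (c + lam ^+ 2) * f x + k * f x))).

Lemma piece_shift lam k c f w (s : R) : piece lam k c f w ->
  piece lam k c (fun x => f (x - s)) (fun x => w (x - s)).
Proof. by move=> [df dw]; split => x; exact: der_shift. Qed.

(** The factor [e^(- lam x)] removes both the first-order term and [lam^2], leaving
    [f'' = - (k + c) f]. *)
Lemma piece_exp lam k c f w : (forall x : R, is_derive x 1 f (w x)) ->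
  (forall x : R, is_derive x 1 w (- (k + c) * f x)) ->
  piece lam k c (fun x => expR (- lam * x) * f x)
                (fun x => expR (- lam * x) * (w x - lam * f x)).
Proof.
move=> df dw; split => x.
  by apply: is_derive_cast (der_mul (der_exp (der_lin _ _)) (df x)) _; rewrite /=; ring.
apply: is_derive_cast
  (der_mul (der_exp (der_lin _ _)) (der_sub (dw x) (der_scale lam (df x)))) _.
by rewrite /=; ring.
Qed.

(** The solution of [y'' = z y] with boundary values [ya] at 0 and [yb] at [len]; [through'] is its
    derivative. Prescribing boundary values rather than initial data makes positivity visible. *)
Definition through (z ya yb len x : R) : R :=
  (ya * gsin z (len - x) + yb * gsin z x) / gsin z len.

Definition through' (z ya yb len x : R) : R :=
  (- ya * gcos z (len - x) + yb * gcos z x) / gsin z len.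

Lemma is_derive_through z ya yb len x :
  is_derive x 1 (through z ya yb len) (through' z ya yb len x).
Proof.
apply: is_derive_cast (der_mul (der_add
  (der_scale ya (der_refl len (is_derive_gsin z (len - x))))
  (der_scale yb (is_derive_gsin z x))) (der_cst _ x)) _.
by rewrite /through'/=; ring.
Qed.

Lemma is_derive_through' z ya yb len x :
  is_derive x 1 (through' z ya yb len) (z * through z ya yb len x).
Proof.
apply: is_derive_cast (der_mul (der_add
  (der_scale (- ya) (der_refl len (is_derive_gcos z (len - x))))
  (der_scale yb (is_derive_gcos z x))) (der_cst _ x)) _.
by rewrite /through/=; ring.
Qed.

Lemma through_left z ya yb len : gsin z len != 0 -> through z ya yb len 0 = ya.
Proof. by move=> s0; rewrite /through subr0 gsin0 mulr0 addr0 mulfK. Qed.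

Lemma through_right z ya yb len : gsin z len != 0 -> through z ya yb len len = yb.
Proof. by move=> s0; rewrite /through subrr gsin0 mulr0 add0r mulfK. Qed.

(** The condition on [z] places [len] before the first zero of [gsin z]; then both summands are
    nonnegative and one is positive. *)
Lemma through_gt0 z ya yb len x : 0 < ya -> 0 < yb -> 0 < len ->
  - z * len ^+ 2 < pi ^+ 2 -> 0 <= x <= len -> 0 < through z ya yb len x.
Proof.
move=> a0 b0 l0 zl /andP[x0 xl].
have S t : 0 < t <= len -> 0 < gsin z t.
  move=> /andP[t0 tl]; apply: gsin_gt0 => //.
  have [z0|z0] := leP 0 (- z); last first.
    apply: (@le_lt_trans _ _ 0); last by rewrite exprn_gt0// pi_gt0.
    by rewrite mulr_le0_ge0 ?sqr_ge0// ltW.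
  apply: le_lt_trans zl; apply: ler_wpM2l => //.
  by rewrite ler_pXn2r// nnegrE ltW.
have S0 t : 0 <= t <= len -> 0 <= gsin z t.
  move=> /andP[]; rewrite le_eqVlt => /predU1P[<-|t0 tl]; first by rewrite gsin0.
  by apply/ltW/S; rewrite t0.
apply: divr_gt0; last by apply: S; rewrite l0/=.
move: x0; rewrite le_eqVlt => /predU1P[<-|x0].
  by rewrite subr0 gsin0 mulr0 addr0 mulr_gt0// S// l0/=.
apply: ltr_wpDl.
  by apply: mulr_ge0; [exact: ltW|apply: S0; lra].
by apply: mulr_gt0 => //; apply: S; rewrite x0.
Qed.

(* Squared, the equation says that the period map at spectral parameter [K] has
   trace [2 cosh a]; the sign imposed by the square root is what makes the
   Floquet solution positive. *)
Lemma floquet_equation m l h a : 0 < m -> 0 < l -> pi ^+ 2 < h * m ^+ 2 ->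
  0 <= a ->
  exists K, [/\ 0 < K, (h - K) * m ^+ 2 < pi ^+ 2 &
    gcos (K - h) m * gsin K l + gcos K l * gsin (K - h) m =
    Num.sqrt (gsin (K - h) m ^+ 2 + gsin K l ^+ 2 +
      2 * coshR a * (gsin (K - h) m * gsin K l))].
Proof.
move=> m0 l0 hm a0.
have m2 : 0 < m ^+ 2 by rewrite exprn_gt0.
have p0 : 0 < pi :> R by exact: pi_gt0.
pose F K := gcos (K - h) m * gsin K l + gcos K l * gsin (K - h) m -
    Num.sqrt (gsin (K - h) m ^+ 2 + gsin K l ^+ 2 +
      2 * coshR a * (gsin (K - h) m * gsin K l)).
(* At [K0] the solution [gsin] has its first zero at the end of the bump, so
   [F K0 = - 2 gsin K0 l < 0]. At [K1] both [gcos] factors are hyperbolic, the second at least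
   [cosh a], which gives [F K1 >= 0]. *)
pose K0 := h - (pi / m) ^+ 2; pose K1 := h + (a / l) ^+ 2.
have K0_gt0 : 0 < K0 by rewrite subr_gt0 expr_div_n ltr_pdivrMr.
have cshift : continuous (fun K => K - h).
  by move=> K; exact: is_derive_continuous (der_sub (der_id K) (der_cst h K)).
have cc : continuous (fun K => gcos (K - h) m).
  exact: continuous_compR cshift (gcos_continuous m).
have cs : continuous (fun K => gsin (K - h) m).
  exact: continuous_compR cshift (gsin_continuous m).
have cC : continuous (fun K : R => gcos K l) by exact: gcos_continuous.
have cS : continuous (fun K : R => gsin K l) by exact: gsin_continuous.
have cF : continuous F.
  apply: continuous_sub; first by apply: continuous_add; apply: continuous_mul.
  apply: (continuous_compR (f := fun K => gsin (K - h) m ^+ 2 +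
    gsin K l ^+ 2 + 2 * coshR a * (gsin (K - h) m * gsin K l)));
    last exact: sqrt_continuous.
  apply: continuous_add; first by apply: continuous_add; apply: continuous_mul.
  apply: continuous_mul => [K|]; first exact: cvg_cst.
  exact: continuous_mul.
have F0 : F K0 < 0.
  have e : K0 - h = - (pi / m) ^+ 2 by rewrite /K0; ring.
  rewrite /F e gsin_pi// gcos_pi// mulr0 addr0 mul0r mulr0.
  rewrite addr0 expr0n add0r sqrtr_sqr.
  have S0 : 0 < gsin K0 l.
    apply: gsin_gt0 => //; apply: (@lt_trans _ _ 0); last by rewrite exprn_gt0.
    by rewrite mulNr oppr_lt0 mulr_gt0// exprn_gt0.
  by rewrite gtr0_norm//; lra.
have F1 : 0 <= F K1.
  have K1h : 0 <= K1 - h by rewrite subr_ge0 lerDl sqr_ge0.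
  have K10 : 0 < K1.
    by apply: (lt_le_trans K0_gt0); rewrite /K0 /K1; have := sqr_ge0 (pi / m);
      have := sqr_ge0 (a / l); lra.
  have sb : 0 < gsin (K1 - h) m.
    apply: gsin_gt0 => //; apply: (@le_lt_trans _ _ 0); last by rewrite exprn_gt0.
    by rewrite mulNr oppr_le0 mulr_ge0// ltW.
  have sg : 0 < gsin K1 l.
    apply: gsin_gt0 => //; apply: (@lt_trans _ _ 0); last by rewrite exprn_gt0.
    by rewrite mulNr oppr_lt0 mulr_gt0// exprn_gt0.
  have cb : 1 <= gcos (K1 - h) m by rewrite gcos_pos// coshR_ge1.
  have cg : coshR a <= gcos K1 l.
    rewrite (gcos_pos _ _ (ltW K10)); apply: coshR_le; rewrite a0/= -ler_pdivrMr//.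
    rewrite -[leLHS](ger0_norm (divr_ge0 a0 (ltW l0))) -sqrtr_sqr.
    rewrite ler_wsqrtr// /K1 lerDr ltW//.
    by rewrite -(pmulr_lgt0 _ m2) (lt_trans _ hm)// exprn_gt0.
  have ca := coshR_ge1 a.
  rewrite /F subr_ge0 -[leRHS]ger0_norm; last first.
    by apply: addr_ge0; apply: mulr_ge0; lra.
  rewrite -sqrtr_sqr ler_wsqrtr//.
  move: sb sg cb cg ca; move: (gsin _ m) (gsin _ l) (gcos _ m) (gcos _ l) (coshR a).
  move=> sb sg cb cg ca sb0 sg0 cb1 cg1 ca1.
  (* After squaring, the two sides compare term by term. *)
  have -> : (cb * sg + cg * sb) ^+ 2 =
    sb ^+ 2 * cg ^+ 2 + sg ^+ 2 * cb ^+ 2 + 2 * (cg * cb) * (sb * sg) by ring.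
  have cg1' : 1 <= cg by exact: le_trans cg1.
  rewrite !lerD//.
  - by rewrite ler_peMr ?sqr_ge0// exprn_ege1.
  - by rewrite ler_peMr ?sqr_ge0// exprn_ege1.
  - apply: ler_wpM2r; first by apply: mulr_ge0; exact: ltW.
    by apply: ler_wpM2l => //; apply: (le_trans cg1); rewrite ler_peMr//; lra.
have K01 : K0 <= K1.
  by rewrite /K0 /K1; have := sqr_ge0 (pi / m); have := sqr_ge0 (a / l); lra.
have [||K] := @IVT R F K0 K1 0 K01.
- exact: continuous_subspaceT.
- by rewrite ge_min le_max (ltW F0) F1 orbT.
rewrite in_itv/= => /andP[K0K _] FK; exists K; split.
- exact: lt_le_trans K0K.
(* The inequality must be strict to keep [gsin (K - h) m] positive; [F K0 < 0] excludes [K = K0]. *)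
- have K0ltK : K0 < K.
    by rewrite lt_neqAle K0K andbT; apply: contraTneq F0 => ->; rewrite FK ltxx.
  rewrite -ltr_pdivlMr// -expr_div_n.
  by move: K0ltK; rewrite /K0; lra.
- by move/eqP: FK; rewrite subr_eq0 => /eqP.
Qed.

(** With [psi = e^(- lam x) y], periodicity of [psi] means that [y] and [y'] are multiplied by
    [mu = e^(lam L)] over a period. Take [y] with values 1, [q], [mu] at 0, [m], [L]: matching [y']
    at [m] determines [q], and matching it over the period is then the Floquet equation. *)
Lemma floquet_pieces L m h lam : 0 < m < L -> pi ^+ 2 < h * m ^+ 2 ->
  0 <= lam ->
  exists k fb wb fg wg,
    [/\ piece lam k h fb wb, piece lam k 0 fg wg,
        (forall x, 0 <= x <= m -> 0 < fb x),
        (forall x, m <= x <= L -> 0 < fg x) &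
        [/\ fb m = fg m, wb m = wg m, fg L = fb 0 & wg L = wb 0]].
Proof.
move=> /andP[m0 mL] hm lam0.
have l0 : 0 < L - m by rewrite subr_gt0.
have L0 : 0 < L by exact: lt_trans mL.
have a0 : 0 <= lam * L by rewrite mulr_ge0// ltW.
have [K [K0 Km]] := floquet_equation m (L - m) h (lam * L) m0 l0 hm a0.
pose mu := expR (lam * L).
have mu0 : 0 < mu by exact: expR_gt0.
have Kl : - K * (L - m) ^+ 2 < pi ^+ 2.
  apply: (@lt_trans _ _ 0); last by rewrite exprn_gt0// pi_gt0.
  by rewrite mulNr oppr_lt0 mulr_gt0// exprn_gt0.
have Km' : - (K - h) * m ^+ 2 < pi ^+ 2 by rewrite opprB.
have Sb0 := gsin_gt0 (K - h) m m0 Km'.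
have Sg0 := gsin_gt0 K (L - m) l0 Kl.
have -> : 2 * coshR (lam * L) = mu + mu^-1.
  by rewrite /coshR expRN -/mu; field; rewrite lt0r_neq0.
set Sb := gsin _ m in Sb0 *; set Sg := gsin _ (L - m) in Sg0 *.
set Cb := gcos _ m; set Cg := gcos _ (L - m).
set T := Cb * Sg + Cg * Sb => TE.
have rad0 : 0 < Sb ^+ 2 + Sg ^+ 2 + (mu + mu^-1) * (Sb * Sg).
  apply: addr_gt0; first by apply: addr_gt0; exact: exprn_gt0.
  by apply: mulr_gt0; [rewrite addr_gt0 ?invr_gt0|exact: mulr_gt0].
have T0 : 0 < T by rewrite TE sqrtr_gt0.
have T2 : T ^+ 2 = Sb ^+ 2 + Sg ^+ 2 + (mu + mu^-1) * (Sb * Sg).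
  by rewrite {1}TE sqr_sqrtr// ltW.
(* Forced by continuity of [y'] at [m], and positive because [T] is: this is where the sign of the
   root enters. *)
pose q := (Sg + mu * Sb) / T.
have q0 : 0 < q by rewrite divr_gt0// addr_gt0// mulr_gt0.
have Sbn := lt0r_neq0 Sb0; have Sgn := lt0r_neq0 Sg0.
have Tn := lt0r_neq0 T0; have mun := lt0r_neq0 mu0.
pose fb := through (K - h) 1 q m; pose wb := through' (K - h) 1 q m.
pose fg x := through K q mu (L - m) (x - m).
pose wg x := through' K q mu (L - m) (x - m).
have e1 : q * T = Sg + mu * Sb by rewrite /q divfK.
(* The condition [y' L = mu * y' 0] cleared of denominators; given [e1], it amounts to the formula
   for [T ^+ 2]. *)
have e2 : q * (mu * Sg + Sb) = mu * T.
  apply: (mulIf Tn); rewrite mulrAC e1 -mulrA -expr2 T2; field; exact: mun.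
exists (- K), (fun x => expR (- lam * x) * fb x),
  (fun x => expR (- lam * x) * (wb x - lam * fb x)),
  (fun x => expR (- lam * x) * fg x),
  (fun x => expR (- lam * x) * (wg x - lam * fg x)).
have fbm : fb m = q by exact: through_right.
have fb0 : fb 0 = 1 by exact: through_left.
have fgm : fg m = q by rewrite /fg subrr; exact: through_left.
have fgL : fg L = mu by exact: through_right.
have wm : wb m = wg m.
  rewrite /wb /wg /through' !subrr subr0 !gcos0 -/Cb -/Cg -/Sb -/Sg.
  apply: (mulIf (mulf_neq0 Sbn Sgn)).
  have -> : (-1 * 1 + q * Cb) / Sb * (Sb * Sg) = q * (Cb * Sg) - Sg.
    by field; exact: Sbn.
  have -> : (- q * Cg + mu * 1) / Sg * (Sb * Sg) = mu * Sb - q * (Cg * Sb).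
    by field; exact: Sgn.
  by move: e1; rewrite /T; lra.
have wL : wg L = mu * wb 0.
  rewrite /wb /wg /through' !subrr subr0 !gcos0 -/Cb -/Cg -/Sb -/Sg.
  apply: (mulIf (mulf_neq0 Sbn Sgn)).
  have -> : (- q * 1 + mu * Cg) / Sg * (Sb * Sg) = mu * (Cg * Sb) - q * Sb.
    by field; exact: Sgn.
  have -> : mu * ((-1 * Cb + q * 1) / Sb) * (Sb * Sg) = q * mu * Sg - mu * (Cb * Sg).
    by field; exact: Sbn.
  by move: e2; rewrite /T; lra.
have emu : expR (- lam * L) * mu = 1 by rewrite /mu -expRD mulNr addNr expR0.
split.
- apply: piece_exp => x; first exact: is_derive_through.
  by apply: is_derive_cast (is_derive_through' _ _ _ _ x) _; rewrite /fb; ring.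
- apply: piece_exp => x; apply: der_shift; first exact: is_derive_through.
  by apply: is_derive_cast (is_derive_through' _ _ _ _ (x - m)) _; rewrite /fg; ring.
- by move=> x xm; rewrite mulr_gt0 ?expR_gt0//; exact: through_gt0.
- move=> x /andP[mx xL]; rewrite mulr_gt0 ?expR_gt0//; apply: through_gt0 => //.
  by rewrite subr_ge0 mx lerD2r.
- split.
  + by rewrite fbm fgm.
  + by rewrite wm fbm fgm.
  + by rewrite fgL fb0 emu mulr0 expR0 mulr1.
  + by rewrite wL fgL fb0 mulr0 expR0 mul1r mulr1 mulrBr mulrA emu mul1r mulrCA emu mulr1.
Qed.

End floquet.

(** * Gluing the pieces periodically *)

Section periodic_extension.
Context {R : realType}.
Implicit Types (f g : R -> R).

Lemma glue_continuous f g (z : R) : f z = g z ->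
  {for z, continuous f} -> {for z, continuous g} ->
  {for z, continuous (fun x => if x <= z then f x else g x)}.
Proof.
move=> fg cf cg; rewrite /prop_for /continuous_at lexx.
apply/cvgrPdist_lt => e e0.
have fe : \forall t \near z, `|f z - f t| < e by move/cvgrPdist_lt: cf; exact.
have ge : \forall t \near z, `|g z - g t| < e by move/cvgrPdist_lt: cg; exact.
by near=> t; case: ifP => _; [near: t|rewrite fg; near: t].
Unshelve. all: by end_near. Qed.

(** The Caratheodory quotients of [f] and [g] take the same value [a] at [z], so they glue to a
    continuous quotient. *)
Lemma glue_derive f g (z a : R) : f z = g z ->
  is_derive z 1 f a -> is_derive z 1 g a ->
  is_derive z 1 (fun x => if x <= z then f x else g x) a.
Proof.
move=> fg /is_derive1_caratheodory[F [FE cF Fz]].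
move=> /is_derive1_caratheodory[G [GE cG Gz]].
apply/is_derive1_caratheodory.
exists (fun x => if x <= z then F x else G x); split.
- by move=> x; rewrite lexx; case: ifP => _; rewrite -?FE ?fg -?GE.
- by apply: glue_continuous => //; rewrite Fz Gz.
- by rewrite lexx.
Qed.

Lemma glue_near (u f g : R -> R) (z e1 e2 : R) : 0 < e1 -> 0 < e2 ->
  (forall x, z - e1 <= x <= z -> u x = f x) ->
  (forall x, z <= x <= z + e2 -> u x = g x) ->
  \forall x \near z, (if x <= z then f x else g x) = u x.
Proof.
move=> e10 e20 uf ug.
have : \forall x \near z, x \in `]z - e1, z + e2[.
  by apply: near_in_itvoo; rewrite in_itv/=; apply/andP; split; lra.
apply: filterS => x; rewrite in_itv/= => /andP[zx xz].
by case: (leP x z) => xz'; [rewrite uf|rewrite ug] => //; rewrite ltW//= ltW.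
Qed.

Section extension.
Variables (L m h lam k : R) (b fb wb fg wg : R -> R).
Hypothesis hm : 0 < m < L.

Definition step_potential : Prop := forall n : int,
  (forall x, n%:~R * L < x < n%:~R * L + m -> b x = h) /\
  (forall x, n%:~R * L + m < x < n%:~R * L + L -> b x = 0).

Hypothesis bstep : step_potential.
Hypotheses (pb : piece lam k h fb wb) (pg : piece lam k 0 fg wg).
Hypotheses (fm : fb m = fg m) (wm : wb m = wg m).
Hypotheses (fL : fg L = fb 0) (wL : wg L = wb 0).

Let L0 : 0 < L. Proof. by case/andP: hm => ? ?; lra. Qed.

Definition glued f g (x : R) : R :=
  let r := x - (Num.floor (x / L))%:~R * L in if r <= m then f r else g r.

Lemma floor_period (n : int) (x : R) :
  n%:~R * L <= x < n%:~R * L + L -> Num.floor (x / L) = n.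
Proof.
move=> /andP[nx xn]; apply: floor_def.
by rewrite ler_pdivlMr// nx ltr_pdivrMr// intrD mulrDl mul1r.
Qed.

Lemma glued_left f g (n : int) (x : R) :
  n%:~R * L <= x <= n%:~R * L + m -> glued f g x = f (x - n%:~R * L).
Proof.
case/andP: hm => m0 mL /andP[nx xn].
rewrite /glued (floor_period n x); last by apply/andP; split; lra.
by rewrite ifT//; lra.
Qed.

Lemma glued_right f g (n : int) (x : R) : f m = g m -> g L = f 0 ->
  n%:~R * L + m <= x <= n%:~R * L + L -> glued f g x = g (x - n%:~R * L).
Proof.
move=> fgm gL /andP[nx xn]; case/andP: hm => m0 mL.
(* For [floor], the right end of the period already belongs to the next one, so the value there is
   [f 0], equal to [g L]. *)
move: xn; rewrite le_eqVlt => /predU1P[xe|xn].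
  rewrite (glued_left _ _ (n + 1)) xe intrD mulrDl mul1r; last by apply/andP; split; lra.
  by rewrite subrr addrAC subrr add0r.
rewrite /glued (floor_period n x); last by apply/andP; split; lra.
case: ifP => // xm; have -> : x - n%:~R * L = m by lra.
by [].
Qed.

Lemma in_period (x : R) : exists n : int, n%:~R * L <= x < n%:~R * L + L.
Proof.
exists (Num.floor (x / L)); have := floor_itv (x / L).
by rewrite ler_pdivlMr// ltr_pdivrMr// intrD mulrDl mul1r.
Qed.

Let psi := glued fb fg.
Let v := glued wb wg.

Lemma glued_periodic f g : f m = g m -> g L = f 0 -> periodic (glued f g) L.
Proof.
move=> fgm gL x; have [n /andP[nx xn]] := in_period x.
have [xm|xm] := leP x (n%:~R * L + m).
  rewrite (glued_left _ _ n x) ?nx// (glued_left _ _ (n + 1)) intrD mulrDl mul1r.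
    by congr f; ring.
  by apply/andP; split; lra.
rewrite (glued_right _ _ n x) ?(ltW xm) ?(ltW xn)//.
rewrite (glued_right _ _ (n + 1))// intrD mulrDl mul1r.
  by congr g; ring.
by apply/andP; split; lra.
Qed.

Lemma glued_gt0 : (forall x, 0 <= x <= m -> 0 < fb x) ->
  (forall x, m <= x <= L -> 0 < fg x) -> forall x, 0 < psi x.
Proof.
move=> fb0 fg0 x; have [n /andP[nx xn]] := in_period x.
have [xm|xm] := leP x (n%:~R * L + m).
  by rewrite /psi (glued_left _ _ n x) ?nx//; apply: fb0; apply/andP; split; lra.
rewrite /psi (glued_right _ _ n x) ?(ltW xm) ?(ltW xn)//.
by apply: fg0; apply/andP; split; lra.
Qed.

(** To the left of each point [psi] coincides with one translated piece. Since pieces are solutions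
    on the whole line, a one-sided germ still has a two-sided derivative at [z], ready for
    [glue_derive]. *)
Lemma left_germ (z : R) : exists e c f w, [/\ 0 < e, piece lam k c f w,
  (forall x, z - e <= x <= z -> psi x = f x /\ v x = w x) &
  (forall x, z - e < x < z -> b x = c)].
Proof.
case/andP: hm => m0 mL; have [n /andP[nz zn]] := in_period z.
have [zm|zm] := ltP (n%:~R * L + m) z.
  exists (z - (n%:~R * L + m)), 0, (fun x => fg (x - n%:~R * L)),
    (fun x => wg (x - n%:~R * L)); split.
  - by rewrite subr_gt0.
  - exact: piece_shift.
  - by move=> x /andP[zx xz]; split; apply: glued_right => //; apply/andP; split; lra.
  - by move=> x /andP[zx xz]; apply: (bstep n).2; apply/andP; split; lra.
move: nz; rewrite le_eqVlt => /predU1P[nz|nz]; last first.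
  exists (z - n%:~R * L), h, (fun x => fb (x - n%:~R * L)),
    (fun x => wb (x - n%:~R * L)); split.
  - by rewrite subr_gt0.
  - exact: piece_shift.
  - by move=> x /andP[zx xz]; split; apply: glued_left => //; apply/andP; split; lra.
  - by move=> x /andP[zx xz]; apply: (bstep n).1; apply/andP; split; lra.
(* Here [z] begins a period, and its left germ is the flat piece of the preceding period. *)
have en : (n - 1)%:~R * L = z - L by rewrite intrD mulrDl mulN1r nz.
exists (L - m), 0, (fun x => fg (x - (n - 1)%:~R * L)),
  (fun x => wg (x - (n - 1)%:~R * L)); split.
- by rewrite subr_gt0.
- exact: piece_shift.
- move=> x /andP[zx xz].
  by split; apply: glued_right => //; rewrite en; apply/andP; split; lra.
- move=> x /andP[zx xz]; apply: (bstep (n - 1)).2.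
  by rewrite en; apply/andP; split; lra.
Qed.

Lemma right_germ (z : R) : exists e c f w, [/\ 0 < e, piece lam k c f w,
  (forall x, z <= x <= z + e -> psi x = f x /\ v x = w x) &
  (forall x, z < x < z + e -> b x = c)].
Proof.
case/andP: hm => m0 mL; have [n /andP[nz zn]] := in_period z.
have [zm|zm] := ltP z (n%:~R * L + m).
  exists (n%:~R * L + m - z), h, (fun x => fb (x - n%:~R * L)),
    (fun x => wb (x - n%:~R * L)); split.
  - by rewrite subr_gt0.
  - exact: piece_shift.
  - by move=> x /andP[zx xz]; split; apply: glued_left => //; apply/andP; split; lra.
  - by move=> x /andP[zx xz]; apply: (bstep n).1; apply/andP; split; lra.
exists (n%:~R * L + L - z), 0, (fun x => fg (x - n%:~R * L)),
  (fun x => wg (x - n%:~R * L)); split.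
- by rewrite subr_gt0.
- exact: piece_shift.
- by move=> x /andP[zx xz]; split; apply: glued_right => //; apply/andP; split; lra.
- by move=> x /andP[zx xz]; apply: (bstep n).2; apply/andP; split; lra.
Qed.

Lemma glued_derive (z : R) : is_derive z 1 psi (v z).
Proof.
have [e1 [c1 [f1 [w1 [e10 [df1 _] E1 _]]]]] := left_germ z.
have [e2 [c2 [f2 [w2 [e20 [df2 _] E2 _]]]]] := right_germ z.
have [pz1 vz1] : psi z = f1 z /\ v z = w1 z by apply: E1; apply/andP; split; lra.
have [pz2 vz2] : psi z = f2 z /\ v z = w2 z by apply: E2; apply/andP; split; lra.
apply: (near_eq_is_derive _ (glue_derive f1 f2 z (v z) _ _ _)).
- by apply: (glue_near _ _ _ _ e1 e2) => // x hx; [case: (E1 x hx)|case: (E2 x hx)].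
- by rewrite -pz1.
- by rewrite vz1.
- by rewrite vz2.
Qed.

Lemma glued_continuous : continuous v.
Proof.
move=> z.
have [e1 [c1 [f1 [w1 [e10 [_ dw1] E1 _]]]]] := left_germ z.
have [e2 [c2 [f2 [w2 [e20 [_ dw2] E2 _]]]]] := right_germ z.
have [pz1 vz1] : psi z = f1 z /\ v z = w1 z by apply: E1; apply/andP; split; lra.
have [pz2 vz2] : psi z = f2 z /\ v z = w2 z by apply: E2; apply/andP; split; lra.
have := glue_continuous w1 w2 z; rewrite -vz1 => /(_ vz2).
move=> /(_ (is_derive_continuous (dw1 z)) (is_derive_continuous (dw2 z))).
rewrite /prop_for /continuous_at lexx -vz1; apply: cvg_trans; apply: near_eq_cvg.
by apply: (glue_near _ _ _ _ e1 e2) => // x hx; [case: (E1 x hx)|case: (E2 x hx)].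
Qed.

Lemma glued_derive1 : derive1 psi = v.
Proof. by apply/funext => z; exact: is_derive_derive1 (glued_derive z). Qed.

Let G (t : R) : R := 2 * lam * v t + (b t + lam ^+ 2) * psi t + k * psi t.

(** Integrability is part of the relation because adding integrals over adjacent segments requires
    it. *)
Let P (x y : R) : Prop :=
  lebesgue_measure.-integrable `[x, y] (EFin \o G) /\
  \int[lebesgue_measure]_(t in `[x, y]) G t = v x - v y.

Let P_piece c f w (x y : R) : x <= y -> piece lam k c f w ->
  (forall t, x <= t <= y -> psi t = f t /\ v t = w t) ->
  (forall t, x < t < y -> b t = c) -> P x y.
Proof.
move=> xy [df dw] E bc.
pose g (t : R) := 2 * lam * w t + (c + lam ^+ 2) * f t + k * f t.
have cf : continuous f by move=> t; exact: is_derive_continuous (df t).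
have cw : continuous w by move=> t; exact: is_derive_continuous (dw t).
have cc (a : R) : continuous (fun _ : R => a) by move=> t; exact: cvg_cst.
have cg : continuous g.
  by do 2?apply: continuous_add; apply: continuous_mul => //; exact: cc.
have Gg t : x < t < y -> G t = g t.
  move=> /[dup] ht /andP[xt ty]; rewrite /G bc//.
  by have [-> ->] : psi t = f t /\ v t = w t by apply: E; rewrite !ltW.
have [iG eG] := integrable_eq_oo G g x y cg Gg.
have dNw (t : R) : is_derive t 1 (fun t => - w t) (g t).
  by apply: is_derive_cast (der_opp (dw t)) _; rewrite opprK.
split=> //; rewrite eG (Rintegral_derive _ _ _ _ xy dNw cg).
have [_ ->] : psi x = f x /\ v x = w x by apply: E; rewrite lexx.
have [_ ->] : psi y = f y /\ v y = w y by apply: E; rewrite lexx xy.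
by rewrite opprK addrC.
Qed.

Lemma glued_integral (x y : R) : x <= y -> P x y.
Proof.
apply: local_to_global => {x y} [x|x y z /andP[xy yz] [ixy exy] [iyz eyz]|z|z].
- split; last by rewrite set_itv1 Rintegral_set1 subrr.
  have [e [c [f [w [e0 pf E bc]]]]] := right_germ x.
  have [] // := P_piece c f w x x (lexx x) pf.
    by move=> t /andP[xt tx]; apply: E; rewrite xt (le_trans tx)// lerDl ltW.
  by move=> t /andP[xt tx]; move: (lt_trans xt tx); rewrite ltxx.
- have [|ixz exz] := Rintegral_chain G x y z _ ixy iyz; first by rewrite xy.
  by split=> //; rewrite exz exy eyz; ring.
- have [e [c [f [w [e0 pf E bc]]]]] := left_germ z; exists e => // x /andP[zx xz].
  apply: (P_piece c f w) => //.
    by move=> t /andP[xt tz]; apply: E; rewrite (le_trans zx).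
  by move=> t /andP[xt tz]; apply: bc; rewrite (le_lt_trans zx).
- have [e [c [f [w [e0 pf E bc]]]]] := right_germ z; exists e => // x /andP[zx xz].
  apply: (P_piece c f w) => //.
    by move=> t /andP[xt tz]; apply: E; rewrite xt (le_trans tz).
  by move=> t /andP[xt tz]; apply: bc; rewrite xt (lt_le_trans tz).
Qed.

Lemma glued_eigen : eigen_solution lam b k psi.
Proof.
split.
- by move=> x; case: (glued_derive x).
- by rewrite glued_derive1; exact: glued_continuous.
- move=> x y xy; rewrite glued_derive1; have [_ ->] := glued_integral x y xy.
  by rewrite opprB.
Qed.

End extension.

Lemma principal_eigenvalue_exists L m h lam (b : R -> R) : 0 < m < L ->
  step_potential L m h b -> pi ^+ 2 < h * m ^+ 2 -> 0 <= lam ->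
  exists k, is_principal_eigenvalue L lam b k.
Proof.
move=> hm bstep hpi lam0.
have [k [fb [wb [fg [wg [pb pg fb0 fg0 [fm wm fL wL]]]]]]] :=
  floquet_pieces L m h lam hm hpi lam0.
exists k, (glued L m fb fg); split.
- exact: glued_gt0.
- exact: glued_periodic.
- exact: (glued_eigen L m h lam k b fb wb fg wg).
Qed.

End periodic_extension.

(** * The minimal speed *)

Section minimal_speed.
Context {R : realType}.
Implicit Types (L m h lam k : R) (b : R -> R).

Lemma step_potential_two_step L m h b :
  step_potential L m h b -> two_step L m h b.
Proof.
move=> /(_ 0)[bl br]; split => x hx.
  by apply: bl; rewrite mul0r add0r.
by apply: br; rewrite mul0r !add0r.
Qed.

Lemma principal_eigenvalueP L lam b :
  (exists k, is_principal_eigenvalue L lam b k) ->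
  is_principal_eigenvalue L lam b (principal_eigenvalue L lam b).
Proof. by move=> ex; exact: (getPex ex). Qed.

Lemma principal_pair L m h lam b k : two_step L m h b ->
  is_principal_eigenvalue L lam b k ->
  exists psi v, step_eigenpair L m lam b k psi v.
Proof.
by move=> bs [psi [p0 pL e]]; exists psi, (derive1 psi); exact: (eigen_pair _ _ h).
Qed.

(* The term [point] accounts for the junk value of [get], so that neither the
   eigenvalue nor the minimum has to exist. *)
Lemma min_speed_le L m h b : 0 < m <= L -> two_step L m h b -> 1 <= h ->
  min_speed L b <= (2 + `|point : R|) * Num.sqrt h.
Proof.
move=> hm bs h1; have h0 : 0 < h by lra.
set r := Num.sqrt h; set d := `|point : R|.
have r0 : 0 < r by rewrite sqrtr_gt0.
have r2 : r ^+ 2 = h by rewrite sqr_sqrtr// ltW.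
have r1 : 1 <= r by rewrite -sqrtr1 ler_wsqrtr.
have d0 : 0 <= d by exact: normr_ge0.
have dr : d <= (2 + d) * r.
  have : d * 1 <= d * r by rewrite ler_wpM2l.
  lra.
rewrite /min_speed; set S := [set _ | _ in _].
have [[c Sc]|noS] := pselect (exists c, minima S c); last first.
  rewrite getPN; last by move=> c Sc; apply: noS; exists c.
  by apply: le_trans dr; exact: ler_norm.
(* The test value [lam = sqrt h] minimizes [(h + lam^2) / lam], with minimum [2 sqrt h]. *)
have [_ /(_ (- principal_eigenvalue L r b / r))] : minima S (get (minima S)).
  by apply: getPex; exists c.
have Sr : S (- principal_eigenvalue L r b / r) by exists r.
move=> /(_ Sr) /le_trans; apply.
rewrite ler_pdivrMr// -mulrA -expr2 r2.
have [ex|no] := pselect (exists k, is_principal_eigenvalue L r b k).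
  have [psi [v ep]] := principal_pair _ _ _ _ _ _ bs (principal_eigenvalueP _ _ _ ex).
  have := eigen_le_sup _ _ _ _ _ _ _ _ hm bs ep (ltW h0) r0.
  rewrite r2 => /le_trans; apply.
  have : 0 <= d * h by rewrite mulr_ge0// ltW.
  lra.
(* Without an eigenvalue [get] returns [point], which [d * h] absorbs because [h >= 1]. *)
rewrite /principal_eigenvalue getPN; last by move=> k ek; apply: no; exists k.
apply: (@le_trans _ _ d); first by rewrite /d -normrN ler_norm.
have : d * 1 <= d * h by rewrite ler_wpM2l.
lra.
Qed.

(** * Attainment of the minimum over [lam] and the lower bound on the speed *)

Section attained.
Variables (L m h : R) (b : R -> R).
Hypotheses (hm : 0 < m < L) (bstep : step_potential L m h b).
Hypothesis (hpi : 2 * pi ^+ 2 <= h * m ^+ 2).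

Let m0 : 0 < m. Proof. by case/andP: hm. Qed.
Let hmL : 0 < m <= L. Proof. by case/andP: hm => -> /ltW. Qed.
Let bs := step_potential_two_step _ _ _ _ bstep.
Let L0 : 0 < L. Proof. by case/andP: hm => hm0; exact: lt_trans. Qed.
Let m2 : 0 < m ^+ 2. Proof. by rewrite exprn_gt0. Qed.
Let p2 : 0 < pi ^+ 2 :> R. Proof. by rewrite exprn_gt0// pi_gt0. Qed.
Let h0 : 0 < h.
Proof.
have : 0 < h * m ^+ 2 by apply: lt_le_trans hpi; rewrite mulr_gt0.
by rewrite pmulr_lgt0.
Qed.

Let K lam : R := - principal_eigenvalue L lam b.

Let pairK lam : 0 < lam -> exists psi v,
  step_eigenpair L m lam b (principal_eigenvalue L lam b) psi v.
Proof.
move=> l0; apply: (principal_pair _ _ h) => //; apply: principal_eigenvalueP.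
apply: (principal_eigenvalue_exists _ m h) => //; last exact: ltW.
by apply: lt_le_trans hpi; have := p2; lra.
Qed.

Let K_ge_sqr lam : 0 < lam -> lam ^+ 2 <= K lam.
Proof.
move=> l0; have [psi [v ep]] := pairK lam l0.
exact: (eigen_ge_sqr _ _ _ _ _ _ _ _ hmL bs ep (ltW h0) l0).
Qed.

(** The hypothesis [hpi] says that [(pi / m)^2] is at most [h / 2], which is all that [K] can lose
    below [h]. *)
Let K_ge_half lam : 0 < lam -> h / 2 <= K lam.
Proof.
move=> l0; have [psi [v ep]] := pairK lam l0.
have := eigen_bump_lt_pi _ _ _ _ _ _ _ _ hmL bs ep.
rewrite /K; move: (principal_eigenvalue L lam b) => k kpi.
rewrite -(ler_pM2r m2); move: kpi hpi; rewrite mulrDl mulNr mulrAC => kpi hpi'.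
lra.
Qed.

(* [K lam - lam ^+ 2] is Lipschitz at [lam] with constant [2 sup |psi'/psi|]. *)
Let K_lipschitz lam : 0 < lam -> exists2 C, 0 <= C &
  forall mu, 0 < mu -> `|(K mu - mu ^+ 2) - (K lam - lam ^+ 2)| <= C * `|mu - lam|.
Proof.
move=> l0; have [psi [v ep]] := pairK lam l0.
have [psi0 dpsi cv _ _ _] := ep.
have pn x : psi x != 0 by exact: lt0r_neq0.
have cpsi : continuous psi by exact: pair_continuous ep.
have cq : continuous (fun x => `|v x * (psi x)^-1|).
  apply: (continuous_compR (f := fun x => v x * (psi x)^-1)); last exact: norm_continuous.
  by apply: continuous_mul => //; exact: continuous_inv.
have [x _ xmax] := EVT_max (ltW L0) (continuous_subspaceT cq).
set M := `|_| in xmax; have M0 : 0 <= M by exact: normr_ge0.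
exists (2 * M); first exact: mulr_ge0.
have vM t : 0 < t < L -> `|v t| <= M * psi t.
  move=> /andP[t0 tL]; rewrite -ler_pdivrMr//.
  have /xmax : t \in `[0, L] by rewrite in_itv/= !ltW.
  by rewrite normrM normfV (gtr0_norm (psi0 t)).
move=> mu mu0; have [psi' [v' ep']] := pairK mu mu0.
rewrite leNgt; apply/negP => big.
(* [D] is minus the difference to be estimated and also the coefficient of [psi] in [eigen_compare].
   With [s = D] the leading term is [D^2 psi], which dominates if the Lipschitz bound fails. *)
pose D := principal_eigenvalue L mu b - principal_eigenvalue L lam b +
  mu ^+ 2 - lam ^+ 2.
have DE : `|K mu - mu ^+ 2 - (K lam - lam ^+ 2)| = `|D|.
  by rewrite -normrN; congr `|_|; rewrite /K /D; ring.
rewrite DE in big.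
have D0 : 0 < `|D| by apply: le_lt_trans big; rewrite !mulr_ge0.
apply: (eigen_compare _ _ _ _ _ _ _ _ _ _ _ D hmL mu0 ep ep') => t ht.
have main : `|2 * (mu - lam) * v t| < `|D| * psi t.
  rewrite !normrM (ger0_norm (ler0n R 2)).
  apply: (@le_lt_trans _ _ (2 * M * `|mu - lam| * psi t)).
    have := vM t ht; rewrite -(ler_pM2l (_ : 0 < 2 :> R))// => H.
    have := ler_wpM2r (normr_ge0 (mu - lam)) H.
    by rewrite (_ : _ * M * _ * _ = 2 * (M * psi t) * `|mu - lam|) 1?(mulrAC 2)//; ring.
  by rewrite ltr_pM2r.
rewrite -/D mulrDr mulrA -expr2 -real_normK ?num_real//.
have : - (`|D| * (`|D| * psi t)) < D * (2 * (mu - lam) * v t).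
  rewrite ltrNl; apply: le_lt_trans (ler_norm _) _; rewrite normrN normrM.
  by rewrite ltr_pM2l.
by rewrite expr2; lra.
Qed.

Let K_continuous lam : 0 < lam -> {for lam, continuous K}.
Proof.
move=> l0; have [C C0 lip] := K_lipschitz lam l0.
have cf : {for lam, continuous (fun mu => K mu - mu ^+ 2)}.
  apply/cvgrPdist_lt => e e0.
  (* [C] may be 0, hence the [+ 1]. *)
  have d0 : 0 < e / (C + 1) by rewrite divr_gt0//; lra.
  have near1 : \forall mu \near lam, `|lam - mu| < e / (C + 1).
    by move/cvgrPdist_lt: (@cvg_id _ (nbhs lam)); exact.
  have near2 : \forall mu \near lam, 0 < mu by exact: (cvgr_gt lam cvg_id 0 l0).
  near=> mu.
  have mu0 : 0 < mu by near: mu.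
  have mu1 : `|lam - mu| < e / (C + 1) by near: mu.
  rewrite distrC; apply: le_lt_trans (lip mu mu0) _; rewrite distrC.
  apply: (@le_lt_trans _ _ ((C + 1) * `|lam - mu|)).
    by apply: ler_wpM2r => //; lra.
  by rewrite mulrC -ltr_pdivlMr//; lra.
have -> : K = fun mu => (K mu - mu ^+ 2) + mu ^+ 2 by apply/funext => mu; rewrite subrK.
by apply: cvgD => //; exact: exprn_continuous.
Unshelve. all: by end_near. Qed.

(** The bounds [K lam >= h / 2] and [K lam >= lam^2] make [K lam / lam] large near 0 and at
    infinity, so the continuous quotient is minimized on a compact interval. *)
Lemma speed_attained : exists2 lam0, 0 < lam0 &
  forall lam, 0 < lam -> K lam0 / lam0 <= K lam / lam.
Proof.
(* Below [a = h / (2 y)] and above [y] the quotient exceeds its value [K 1] at 1, a point of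
   [[a, y]]. *)
pose y := K 1 + 1.
have K1 : 1 <= K 1 by have := K_ge_sqr 1 ltr01; rewrite expr1n.
have Kh := K_ge_half 1 ltr01.
have y0 : 0 < y by rewrite /y; lra.
pose a := h / 2 / y.
have a0 : 0 < a by rewrite !divr_gt0.
have a1 : a <= 1 by rewrite ler_pdivrMr// mul1r /y; lra.
have y1 : 1 <= y by rewrite /y; lra.
have ay : a <= y by exact: le_trans y1.
have cK : {within `[a, y], continuous (fun lam => K lam / lam)}.
  apply: continuous_in_subspaceT => lam; rewrite inE/= in_itv/= => /andP[al _].
  have l0 : 0 < lam by exact: lt_le_trans al.
  apply: cvgM; first exact: K_continuous.
  by apply: cvgV; [exact: lt0r_neq0|exact: cvg_id].
have [c] := EVT_min ay cK; rewrite in_itv/= => /andP[ac cy] cmin.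
exists c => [|lam l0]; first exact: lt_le_trans ac.
have c1 : K c / c <= K 1.
  by rewrite -[leRHS]divr1; apply: cmin; rewrite in_itv/= a1 y1.
have [la|al] := ltP lam a.
  apply: (le_trans c1); rewrite ler_pdivlMr//; apply: le_trans (K_ge_half lam l0).
  have : y * lam < h / 2 by rewrite mulrC -ltr_pdivlMr.
  by rewrite /y mulrDl mul1r; lra.
have [ly|yl] := leP lam y; first by apply: cmin; rewrite in_itv/= al ly.
apply: (le_trans c1); rewrite ler_pdivlMr//; apply: le_trans (K_ge_sqr lam l0).
by rewrite expr2 ler_wpM2r ?(ltW l0)//; move: yl; rewrite /y; lra.
Qed.

(** At the minimizing [lam], use [K lam >= lam^2] if [lam >= sqrt (h / 2)], and [K lam >= h / 2]
    otherwise. *)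
Lemma min_speed_ge : Num.sqrt (h / 2) <= min_speed L b.
Proof.
have [lam0 l0 lmin] := speed_attained.
rewrite /min_speed; set S := [set _ | _ in _].
have Sne : exists c, minima S c.
  exists (K lam0 / lam0); split; first by exists lam0.
  by move=> _ [lam lam_gt0 <-]; exact: lmin.
have [[lam lam_gt0 <-] _] : minima S (get (minima S)) by exact: getPex.
rewrite -/(K lam); rewrite ler_pdivlMr//.
have h2 : 0 < h / 2 by rewrite divr_gt0.
have s0 : 0 < Num.sqrt (h / 2) by rewrite sqrtr_gt0.
have [sl|ls] := leP (Num.sqrt (h / 2)) lam.
  by apply: le_trans (K_ge_sqr lam lam_gt0); rewrite expr2 ler_pM2r.
apply: le_trans (K_ge_half lam lam_gt0).
by rewrite -[leRHS]sqr_sqrtr ?(ltW h2)// expr2 ler_pM2l// ltW.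
Qed.

End attained.

Lemma step_function_potential L p t (c : R) : 0 < L -> 0 < t <= 1 ->
  step_potential L (t * L) (c * t `^ (- p^-1))
    (fun x => c * step_function L p t x).
Proof.
move=> L0 /andP[t0 t1] n.
have ind1 (y : R) : n%:~R < y < n%:~R + t ->
    \1_(`[n%:~R, n%:~R + t] : set R) y = 1 :> R.
  by move=> /andP[ny yn]; rewrite indicE mem_set//= in_itv/= !ltW.
(* As [t <= 1], a point strictly between [n] and [n + 1] can lie only in the bump of index [n];
   neighbouring bumps meet at most at integers. *)
have ind0 (k : int) (y : R) : n%:~R < y < n%:~R + 1 ->
    (k == n -> n%:~R + t < y) -> \1_(`[k%:~R, k%:~R + t] : set R) y = 0 :> R.
  move=> /andP[ny yn] kn; rewrite indicE memNset//= in_itv/= => /andP[ky yk].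
  have kn1 : k <= n by rewrite -ltzD1 -(ltr_int R) intrD (le_lt_trans ky).
  have nk : n <= k.
    rewrite -ltzD1 -(ltr_int R) intrD; apply: (lt_le_trans ny).
    by apply: le_trans yk _; rewrite lerD2l.
  have kE : k = n by apply/eqP; rewrite eq_le kn1 nk.
  by have := kn (introT eqP kE); rewrite ltNge -kE yk.
split=> x /andP[nx xn]; rewrite /step_function.
  have ny : n%:~R < x / L by rewrite ltr_pdivlMr.
  have yn : x / L < n%:~R + t by rewrite ltr_pdivrMr// mulrDl.
  rewrite -(fsbig_widen [set n])//=; first by rewrite fsbig_set1 ind1 ?mulr1// ny.
  move=> k /= [_ kn]; rewrite ind0 ?mulr0//.
    by rewrite ny (lt_le_trans yn)// lerD2l.
  by move=> /eqP kE; exfalso; exact: kn.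
rewrite fsbig1 ?mulr0// => k _; rewrite ind0 ?mulr0//.
  rewrite ltr_pdivlMr// ltr_pdivrMr// mulrDl mul1r xn andbT.
  by apply: lt_trans nx; rewrite ltrDl mulr_gt0.
by move=> _; rewrite ltr_pdivlMr// mulrDl.
Qed.

Lemma powR_half (x p : R) : 0 < x -> p != 0 ->
  Num.sqrt (x `^ p^-1) = x `^ (2 * p)^-1.
Proof.
move=> x0 p0; have -> : p^-1 = (2 * p)^-1 + (2 * p)^-1 by field.
rewrite powRD; last by rewrite lt0r_neq0// implybT.
by rewrite -expr2 sqrtr_sqr ger0_norm// powR_ge0.
Qed.

Lemma powR_inv_ge (x p c : R) : 0 < p -> 0 <= c -> c `^ p <= x -> c <= x `^ p^-1.
Proof.
move=> p0 c0 cx.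
have cE : c = (c `^ p) `^ p^-1 by rewrite -powRrM divff ?lt0r_neq0// powRr1.
rewrite {1}cE; apply: ge0_ler_powR; rewrite ?invr_ge0 ?nnegrE ?powR_ge0//.
  exact: ltW.
by apply: le_trans cx; exact: powR_ge0.
Qed.

Lemma powRN_le (x y r : R) : 0 <= r -> 0 < x -> x <= y -> y `^ (- r) <= x `^ (- r).
Proof.
move=> r0 x0 xy; have y0 : 0 < y by exact: lt_le_trans xy.
rewrite !powRN lef_pV2 ?posrE ?powR_gt0//.
by apply: ge0_ler_powR => //; rewrite nnegrE ltW.
Qed.

End minimal_speed.

Theorem theorem2p12 (R : realType) (L p : R) (theta : R -> R)
  (hL : 0 < L) (hp : 1 < p)
  (htheta : forall beta : R, 0 < beta -> 0 < theta beta <= 1)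
  (hmax : forall beta : R, 0 < beta ->
     forall t : R, 0 < t <= 1 ->
       min_speed L (fun x => beta `^ p^-1 * step_function L p t x) <=
       min_speed L (fun x => beta `^ p^-1 * step_function L p (theta beta) x)) :
  theta beta @[beta --> +oo] --> (0 : R) /\
  min_speed L (fun x => beta `^ p^-1 * step_function L p (theta beta) x)
    / beta `^ (2 * p)^-1 @[beta --> +oo] --> +oo.

Proof.
have p0 : 0 < p by exact: lt_trans hp.
have pn : p != 0 by exact: lt0r_neq0.
pose c (beta t : R) : R :=
  min_speed L (fun x => beta `^ p^-1 * step_function L p t x).
have speed_ge (M : R) : 0 <= M ->
    \forall beta \near +oo, M * beta `^ (2 * p)^-1 <= c beta (theta beta).
  (* The fixed trial parameter [t] has [t^(-1/p) = s], so the height is [h = beta^(1/p) s], and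
     [sqrt (h / 2) = beta^(1/(2p)) sqrt (M^2 + 1)] exceeds the target. *)
  move=> M0; pose s := 2 * M ^+ 2 + 2; pose t := s `^ (- p).
  have s2 : 2 <= s by rewrite lerDr mulr_ge0// sqr_ge0.
  have t0 : 0 < t by rewrite powR_gt0//; lra.
  have t1 : t < 1.
    rewrite /t powRN invf_lt1 ?powR_gt0; [|lra..].
    apply: (@lt_le_trans _ _ s); first lra.
    rewrite -{1}(powRr1 (a := s)); last lra.
    by apply: ler_powR; [lra|exact: ltW].
  have ts : t `^ (- p^-1) = s.
    by rewrite /t -powRrM mulrNN divff// powRr1//; lra.
  have tL : 0 < t * L < L by rewrite mulr_gt0//= gtr_pMl.
  have tL2 : 0 < (t * L) ^+ 2 by rewrite exprn_gt0//; case/andP: tL.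
  (* Once [beta^(1/p) >= C], the bump of length [t * L] satisfies the hypothesis of
     [min_speed_ge]. *)
  pose C := 2 * pi ^+ 2 / (t * L) ^+ 2 : R.
  have C0 : 0 <= C by apply: divr_ge0; [apply: mulr_ge0 => //|]; exact: sqr_ge0.
  near=> beta.
  have beta0 : 0 < beta by near: beta; exact: nbhs_pinfty_gt.
  have betaC : C `^ p <= beta by near: beta; exact: nbhs_pinfty_ge.
  have AC := powR_inv_ge _ _ _ p0 C0 betaC.
  have A0 : 0 < beta `^ p^-1 by exact: powR_gt0.
  apply: le_trans (hmax beta beta0 t _); last by rewrite t0 ltW.
  have tle : 0 < t <= 1 by rewrite t0 ltW.
  have := step_function_potential L p t (beta `^ p^-1) hL tle; rewrite ts => bs.
  have hC : 2 * pi ^+ 2 <= beta `^ p^-1 * s * (t * L) ^+ 2.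
    rewrite -ler_pdivrMr//; apply: (le_trans AC).
    by rewrite ler_peMr ?(ltW A0)//; lra.
  apply: le_trans (min_speed_ge _ _ _ _ tL bs hC).
  rewrite -mulrA sqrtrM ?(ltW A0)// (powR_half _ _ beta0 pn) mulrC.
  apply: ler_wpM2l; first exact: powR_ge0.
  rewrite -[leLHS](ger0_norm M0) -sqrtr_sqr ler_wsqrtr// /s.
  by rewrite mulrDl mulrAC divff// mul1r lerDl.
have ratio : c beta (theta beta) / beta `^ (2 * p)^-1 @[beta --> +oo] --> +oo.
  apply/cvgryPge => A.
  have nA := speed_ge `|A| (normr_ge0 A).
  near=> beta.
  have beta0 : 0 < beta by near: beta; exact: nbhs_pinfty_gt.
  rewrite ler_pdivlMr ?powR_gt0//.
  apply: (@le_trans _ _ (`|A| * beta `^ (2 * p)^-1)).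
    by rewrite ler_wpM2r ?powR_ge0// ler_norm.
  by near: beta.
split; last exact: ratio.
apply/cvgr0Pnorm_lt => e e0.
(* If [theta beta >= e], the height is at most [beta^(1/p) e^(-1/p)], and [min_speed_le] bounds the
   speed by [D * beta^(1/(2p))], against the lower bound with [D + 1]. *)
pose D := (2 + `|point : R|) * Num.sqrt (e `^ (- p^-1)).
have D0 : 0 <= D by rewrite mulr_ge0 ?addr_ge0 ?sqrtr_ge0.
have nD := speed_ge (D + 1) (addr_ge0 D0 ler01).
near=> beta.
have beta1 : 1 <= beta by near: beta; exact: nbhs_pinfty_ge.
have beta0 : 0 < beta by exact: lt_le_trans beta1.
have /andP[th0 th1] := htheta beta beta0.
rewrite gtr0_norm// ltNge; apply/negP => eth.
have B0 : 0 < beta `^ (2 * p)^-1 by exact: powR_gt0.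
have ip0 : 0 <= p^-1 by rewrite invr_ge0 ltW.
have lower : (D + 1) * beta `^ (2 * p)^-1 <= c beta (theta beta) by near: beta.
have bs := step_potential_two_step _ _ _ _
  (step_function_potential L p _ (beta `^ p^-1) hL (htheta beta beta0)).
have thL : 0 < theta beta * L <= L by rewrite mulr_gt0//= ger_pMl.
(* The height is at least 1 because [beta >= 1] and [theta beta <= 1], as [min_speed_le]
   requires. *)
have h1 : 1 <= beta `^ p^-1 * theta beta `^ (- p^-1).
  rewrite -[leLHS]mulr1; apply: ler_pM => //.
    by apply: powR_inv_ge => //; rewrite powR1.
  by apply: le_trans (powRN_le _ _ _ ip0 th0 th1); rewrite powR1.
have := min_speed_le _ _ _ _ thL bs h1; rewrite -/(c _ _) => upper.
have := le_trans lower upper; apply/negP; rewrite -ltNge.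
rewrite sqrtrM ?powR_ge0// (powR_half _ _ beta0 pn) mulrCA mulrC ltr_pM2r//.
apply: (@le_lt_trans _ _ D); last by rewrite ltrDl.
apply: ler_wpM2l; first by rewrite addr_ge0.
by apply: ler_wsqrtr; exact: powRN_le.
Unshelve. all: by end_near. Qed.
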